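(* Let $\mathcal{A}$ be a sharp arrangement in $\mathbb{R}^d$. Then for any very generic vector $v\in\mathbb{R}^d$ with respect to $\mathcal{A}$, \[P_{\mathcal{A}}(z)=\sum_{C\subseteq\mathsf{h}_v^-}z^{\operatorname{des}_{\preceq_{B(v)}}(C)},\] where the sum is over all regions $C$ of $\mathcal{A}$ contained in $\mathsf{h}_v^-=\{x:\langle x,v\rangle\le 0\}$, $B(v)$ is the unique region containing $v$, and $\operatorname{des}_{\preceq_{B(v)}}(C)$ is the number of regions covered by $C$ in the weak order with base region $B(v)$.
   Context: $\mathcal{A}$ is a finite set of linear hyperplanes in $\mathbb{R}^d$. Flats: intersections of subsets of $\mathcal{A}$, lattice $\mathcal{L}[\mathcal{A}]$ under inclusion with minimum $\bot=\bigcap\mathcal{A}$, Möbius function $\mu$; $P_{\mathcal{A}}(z)=\sum_{\mathrm{X}}|\mu(\bot,\mathrm{X})|(z-1)^{\operatorname{codim}\mathrm{X}}$. Regions: closures of connected components of the complement of $\bigcup\mathcal{A}$. $\mathcal{A}$ is simplicial if each region contains exactly $\operatorname{rank}(\mathcal{A})$ faces of rank one. $\mathcal{A}$ is sharp if it is simplicial and, for every region $C$ (of the essentialization, i.e. the intersection of $\mathcal{A}$ with $\bot^\perp$), the angle between any two facets of $C$ is at most $\pi/2$; equivalently, if $n_1,\dots,n_d$ are inward normals of the facets of a region of the essential arrangement, $\langle n_i,n_j\rangle\le 0$ for $i\neq j$. A hyperplane is generic w.r.t. $\mathcal{A}$ if it contains $\bot$ and no other flat; a vector $v$ is very generic if it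 lies in no hyperplane of $\mathcal{A}$ and the hyperplane $v^\perp$ is generic. Weak order with base region $B$: $C\preceq_B D$ iff every hyperplane separating $B$ and $C$ also separates $B$ and $D$. *)

(* Defs.v *)
From HB Require Import structures.
From mathcomp Require Import all_boot all_order all_algebra.
From mathcomp Require Import all_classical all_reals all_analysis.
Set Implicit Arguments. Unset Strict Implicit. Unset Printing Implicit Defensive.
Import Order.TTheory GRing.Theory Num.Theory numFieldNormedType.Exports.
Local Open Scope classical_set_scope.
Local Open Scope ring_scope.

Section Arrangements.
Variables (R : realType) (d : nat).
Notation V := 'rV[R]_d.

Definition dotv (x y : V) : R := \sum_(i < d) x ord0 i * y ord0 i.

Definition lin_hyperplane (H : set V) : Prop :=
  exists a : V, a != 0 /\ H = [set x | dotv a x = 0].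

Definition arrangement (A : set (set V)) : Prop :=
  finite_set A /\ forall H, A H -> lin_hyperplane H.

(* flats: intersections of subsets of A (empty intersection = whole space) *)
Definition flat (A : set (set V)) (X : set V) : Prop :=
  exists S, S `<=` A /\ X = \bigcap_(H in S) H.

Definition bot (A : set (set V)) : set V := \bigcap_(H in A) H.

(* dimension of the linear span of a set: the largest number of linearly
   independent vectors it contains *)
Definition dims (X : set V) : nat :=
  (\max_(n < d.+1 | `[< exists M : 'M[R]_(n, d),
        (forall i, X (row i M)) /\ row_free M >]) n)%N.

Definition codim (X : set V) : nat := (d - dims X)%N.

(* Moebius function mu(bot, X) on the lattice of flats ordered by inclusion,
   via its defining recursion mu(bot,bot)=1, mu(bot,X) = - sum_{bot<=Y<X} mu(bot,Y).
   The fuel k only needs to exceed the length of chains of flats, which is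
   at most d; we use d.+1. *)
Fixpoint mob_fuel (A : set (set V)) (k : nat) (X : set V) : int :=
  match k with
  | 0 => 0
  | k'.+1 => if `[< X = bot A >] then 1
             else - \sum_(Y \in [set Y | flat A Y /\ bot A `<=` Y /\ Y `<` X])
                      mob_fuel A k' Y
  end.

Definition mobius (A : set (set V)) (X : set V) : int := mob_fuel A d.+1 X.

Definition arr_poly (A : set (set V)) : {poly int} :=
  \sum_(X \in [set X | flat A X]) (`|mobius A X|)%:P * ('X - 1) ^+ codim X.

Definition arr_complement (A : set (set V)) : set V :=
  ~` \bigcup_(H in A) H.

Definition region (A : set (set V)) (C : set V) : Prop :=
  exists x, arr_complement A x /\
            C = closure (connected_component (arr_complement A) x).

Definition face (A : set (set V)) (F : set V) : Prop :=
  exists X x, flat A X /\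
    let S := X `\` \bigcup_(H in [set H | A H /\ ~ (X `<=` H)]) H in
    S x /\ F = closure (connected_component S x).

Definition arr_rank (A : set (set V)) : nat := (d - dims (bot A))%N.

Definition face_rank (A : set (set V)) (F : set V) : nat :=
  (dims F - dims (bot A))%N.

Definition simplicial (A : set (set V)) : Prop :=
  forall C, region A C ->
    card_eq [set F | face A F /\ face_rank A F = 1%N /\ F `<=` C] `I_(arr_rank A).

Definition facet (A : set (set V)) (C F : set V) : Prop :=
  exists H, A H /\ F = C `&` H /\ dims F = (d - 1)%N.

(* inward normal, taken in the essentialization (orthogonal to bot) *)
Definition inward_normal (A : set (set V)) (C F : set V) (n : V) : Prop :=
  [/\ n != 0, (forall y, bot A y -> dotv n y = 0),
      (forall x, F x -> dotv n x = 0) & (forall x, C x -> 0 <= dotv n x)].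

Definition sharp (A : set (set V)) : Prop :=
  simplicial A /\
  forall C F1 F2 n1 n2, region A C -> facet A C F1 -> facet A C F2 ->
    F1 <> F2 -> inward_normal A C F1 n1 -> inward_normal A C F2 n2 ->
    dotv n1 n2 <= 0.

Definition orth (v : V) : set V := [set x | dotv x v = 0].

Definition generic_hyperplane (A : set (set V)) (K : set V) : Prop :=
  lin_hyperplane K /\ bot A `<=` K /\
  forall X, flat A X -> X `<=` K -> X = bot A.

Definition very_generic (A : set (set V)) (v : V) : Prop :=
  (forall H, A H -> ~ H v) /\ generic_hyperplane A (orth v).

Definition separates (H C D : set V) : Prop :=
  exists a : V, H = [set x | dotv a x = 0] /\
    (forall x, C x -> dotv a x <= 0) /\ (forall x, D x -> 0 <= dotv a x).

Definition weak_le (A : set (set V)) (B C D : set V) : Prop :=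
  forall H, A H -> separates H B C -> separates H B D.

Definition covered_by (A : set (set V)) (B D C : set V) : Prop :=
  [/\ region A D, weak_le A B D C, D <> C &
      ~ exists E, [/\ region A E, weak_le A B D E, weak_le A B E C,
                      E <> D & E <> C]].

Definition des (A : set (set V)) (B C : set V) : nat :=
  (\sum_(D \in [set D | covered_by A B D C]) 1)%N.

Definition neg_halfspace (v : V) : set V := [set x | dotv x v <= 0].

End Arrangements.

(* Main.v *)
(* By the recursion defining mu and an Euler characteristic count,
   |mu(bot, X)| is the number of faces spanning the flat X that lie in the
   half-space h_v^-: cutting a relatively open cell by a hyperplane replaces
   (-1)^k by (-1)^k + (-1)^k - (-1)^k, so the signed count of the faces of X
   in h_v^- equals that of a closed half-space of X, which is 0 if X <> bot.
   Hence P_A(z) is the sum of (z-1)^(codim F) over the faces F in h_v^-.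
   Map a face F to the region C = F o (-v), the largest region containing F
   in the weak order based at B(v).  As C is a simplicial cone, the faces sent
   to C are the intersections of C with sets of descent walls, and they
   contribute z^(des C).  Sharpness makes F and C lie in h_v^- simultaneously:
   the Gram matrix of the inward normals of C is an M-matrix. *)
Require Import Defs.
From HB Require Import structures.
From mathcomp Require Import all_boot all_order all_algebra.
From mathcomp Require Import all_classical all_reals all_analysis.
From mathcomp Require Import ring lra zify.
Set Implicit Arguments. Unset Strict Implicit. Unset Printing Implicit Defensive.
Import Order.TTheory GRing.Theory Num.Theory numFieldNormedType.Exports.
Local Open Scope classical_set_scope.
Local Open Scope ring_scope.

(** Faces are handled as sign vectors on an indexed family of normals, so the Euler count uses no
    topology: a nonempty cell counts as plus or minus one according to the rank of its equations,
    and cutting it concerns only three sign choices. The topological definitions of face and region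
    are matched with sign vectors once and for all. The arrangement may be non-essential. Rays are
    only meaningful modulo [bot], while the normals, and by genericity [v], are orthogonal to [bot],
    so all pairings are well defined. The delicate point is that a region lies in the half-space as
    soon as the face F mapped to it does. The rays of F pair nonpositively with [v]; every other ray
    is opposite to a wall through F, and [v] is on the negative side of that wall. The pairings of
    [v] with the rays are its coordinates in the basis of inward normals. As these normals have
    pairwise nonpositive products, the positive part of that expansion has norm zero, so no ray
    pairs positively with [v]. *)

(** * The standard scalar product *)

Section DotProduct.
Variables (R : realType) (d : nat).
Implicit Types (x y z : 'rV[R]_d) (t : R).

Lemma dotvE x y : dotv x y = (x *m y^T) ord0 ord0.
Proof. by rewrite mxE; apply: eq_bigr => i _; rewrite mxE. Qed.

Lemma dotvC x y : dotv x y = dotv y x.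
Proof. by apply: eq_bigr => i _; rewrite mulrC. Qed.

Lemma dotvDr x y z : dotv x (y + z) = dotv x y + dotv x z.
Proof. by rewrite !dotvE linearD mulmxDr mxE. Qed.

Lemma dotvZr t x y : dotv x (t *: y) = t * dotv x y.
Proof. by rewrite !dotvE linearZ /= -scalemxAr mxE. Qed.

Lemma dotvZl t x y : dotv (t *: x) y = t * dotv x y.
Proof. by rewrite dotvC dotvZr dotvC. Qed.

Lemma dotvNr x y : dotv x (- y) = - dotv x y.
Proof. by rewrite -scaleN1r dotvZr mulN1r. Qed.

Lemma dotvBr x y z : dotv x (y - z) = dotv x y - dotv x z.
Proof. by rewrite dotvDr dotvNr. Qed.

Lemma dotv0r x : dotv x 0 = 0.
Proof. by rewrite -(scale0r 0) dotvZr mul0r. Qed.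

Lemma dotv_sumr x (I : Type) (r : seq I) (P : pred I) (F : I -> 'rV[R]_d) :
  dotv x (\sum_(i <- r | P i) F i) = \sum_(i <- r | P i) dotv x (F i).
Proof.
by elim/big_rec2: _ => [|i y1 y2 _ <-]; rewrite ?dotv0r ?dotvDr.
Qed.

Lemma dotvv_eq0 x : dotv x x = 0 -> x = 0.
Proof.
move=> xx0; apply/rowP => i; rewrite mxE; apply/eqP; rewrite -sqrf_eq0 expr2.
have := xx0; rewrite /dotv => /eqP; rewrite psumr_eq0 => [/allP /(_ i)|j _].
  by rewrite mem_index_enum => /(_ isT).
exact: sqr_ge0.
Qed.

Lemma dotvv_ge0 x : 0 <= dotv x x.
Proof. by apply: sumr_ge0 => i _; exact: sqr_ge0. Qed.

Lemma dotv_eq0P x y : dotv x y = 0 <-> x *m y^T = 0.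
Proof.
rewrite dotvE; split=> [e|->]; last by rewrite mxE.
by apply/matrixP => i j; rewrite !ord1 e mxE.
Qed.

End DotProduct.

Section Signs.
Variable R : realType.
Implicit Type r : R.

(* [None] is the sign of [0]. *)
Definition sg3 r : option bool := if r == 0 then None else Some (0 < r).

Lemma sg3_0P r : sg3 r = None <-> r = 0.
Proof. by rewrite /sg3; case: eqVneq => // /eqP. Qed.

Lemma sg3_posP r : sg3 r = Some true <-> 0 < r.
Proof.
rewrite /sg3; case: eqVneq => [->|r0]; first by rewrite ltxx.
by split=> [[]|->].
Qed.

Lemma sg3_negP r : sg3 r = Some false <-> r < 0.
Proof.
rewrite /sg3; case: eqVneq => [->|r0]; first by rewrite ltxx.
by split=> [[]|]; case: ltgtP r0.
Qed.

Variant sg3_spec r : option bool -> Type :=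
  | Sg3Pos of 0 < r : sg3_spec r (Some true)
  | Sg3Neg of r < 0 : sg3_spec r (Some false)
  | Sg3Zero of r = 0 : sg3_spec r None.

Lemma sg3P r : sg3_spec r (sg3 r).
Proof.
case e : (sg3 r) => [[]|]; constructor.
- exact/sg3_posP.
- exact/sg3_negP.
- exact/sg3_0P.
Qed.

Lemma sg3M t r : 0 < t -> sg3 (t * r) = sg3 r.
Proof. by move=> t0; rewrite /sg3 mulf_eq0 gt_eqF //= pmulr_rgt0. Qed.

End Signs.

(** * Relatively open polyhedral cones and their linear spans *)

Section Cells.
Variables (R : realType) (d : nat).
Notation V := 'rV[R]_d.
Notation constr := (V * option bool)%type.
Implicit Types (x y : V) (c : seq constr).

Definition cell c x := forall p, p \in c -> sg3 (dotv p.1 x) = p.2.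

(* The linear span of [cell c] when that cell is nonempty. *)
Definition cell_flat c x := forall p, p \in c -> p.2 = None -> dotv p.1 x = 0.

Lemma cell_cons p c x : cell (p :: c) x <-> sg3 (dotv p.1 x) = p.2 /\ cell c x.
Proof.
split=> [h|[h1 h2] q].
  by split=> [|q qc]; apply: h; rewrite inE ?eqxx // qc orbT.
by rewrite inE => /predU1P[->//|/h2].
Qed.

Lemma cell_sub_flat c x : cell c x -> cell_flat c x.
Proof. by move=> cx p pc e; apply/sg3_0P; rewrite cx. Qed.

Lemma sg3_perturb (L : seq V) x y : exists2 e : R, 0 < e &
  forall t : R, `|t| <= e -> forall b, b \in L -> dotv b x != 0 ->
    sg3 (dotv b (x + t *: y)) = sg3 (dotv b x).
Proof.
elim: L => [|b L [e e0 IH]]; first by exists 1.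
have [bx0|bx0] := eqVneq (dotv b x) 0.
  exists e => // t te b'; rewrite inE => /predU1P[->|]; last exact: IH.
  by rewrite bx0 eqxx.
have nx : 0 < `|dotv b x| by rewrite normr_gt0.
have ny : 0 < `|dotv b y| + 1 by rewrite ltr_wpDl.
(* The [+ 1] keeps the denominator positive when [dotv b y] vanishes and makes the bound on
   [t * dotv b y] strict. *)
exists (Num.min e (`|dotv b x| / (`|dotv b y| + 1))).
  by rewrite lt_min e0 divr_gt0.
move=> t; rewrite le_min => /andP[te tb] b'; rewrite inE => /predU1P[->|]; last exact: IH.
move=> _; rewrite dotvDr dotvZr.
have : `|t * dotv b y| < `|dotv b x|.
  rewrite normrM; have [->|t0] := eqVneq t 0; first by rewrite normr0 mul0r.
  rewrite ler_pdivlMr // in tb; apply: lt_le_trans tb.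
  by rewrite ltr_pM2l ?normr_gt0 // ltrDl.
move: bx0; set u := dotv b x; set w : R := t * _ => u0; rewrite ltr_norml => /andP[].
case: (sg3P u) => [uu|uu|/eqP]; last by rewrite (negbTE u0).
  by rewrite gtr0_norm // => *; apply/sg3_posP; lra.
by rewrite ltr0_norm // => *; apply/sg3_negP; lra.
Qed.

Lemma cell_perturb c x y : cell c x -> cell_flat c y -> exists2 e : R, 0 < e &
  forall t : R, `|t| <= e -> cell c (x + t *: y).
Proof.
move=> cx fy; have [e e0 he] := sg3_perturb (map fst c) x y.
exists e => // t te p pc; case e2 : p.2 => [s|]; last first.
  by apply/sg3_0P; rewrite dotvDr dotvZr fy // mulr0 addr0; apply/sg3_0P; rewrite cx.
rewrite he //; first by rewrite cx.
  exact: map_f.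
by apply/eqP => /sg3_0P; rewrite cx // e2.
Qed.

Lemma cell_convex c x y s t : 0 < s -> 0 < t -> cell c x -> cell c y ->
  cell c (s *: x + t *: y).
Proof.
move=> s0 t0 cx cy p pc; rewrite dotvDr !dotvZr.
have := cx p pc; have := cy p pc; case: p.2 => [[]|].
- by move=> /sg3_posP h1 /sg3_posP h2; apply/sg3_posP; rewrite addr_gt0 // mulr_gt0.
- move=> /sg3_negP h1 /sg3_negP h2; apply/sg3_negP.
  by rewrite addrC ltr_wnDl ?pmulr_rlt0 // pmulr_rle0 // ltW.
- by move=> /sg3_0P h1 /sg3_0P h2; apply/sg3_0P; rewrite h1 h2 !mulr0 addr0.
Qed.

Definition znormals c : 'M[R]_d :=
  (\sum_(p <- c | p.2 == None) <<p.1>>)%MS.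

Lemma cell_flatP c x : cell_flat c x <-> znormals c *m x^T = 0.
Proof.
rewrite /znormals; elim: c => [|p c IH].
  by rewrite big_nil mul0mx; split.
have -> : cell_flat (p :: c) x <->
    (p.2 = None -> dotv p.1 x = 0) /\ cell_flat c x.
  split=> [h|[h1 h2] q].
    split=> [|q qc]; apply: h; rewrite inE ?eqxx //.
    by rewrite qc orbT.
  by rewrite inE => /predU1P[->//|/h2].
rewrite big_cons; case: eqP => [e|ne]; last by split=> [[_ /IH]|/IH].
rewrite IH; set S := bigop _ _ _.
have k (m : nat) (M : 'M[R]_(m, d)) : M *m x^T = 0 <-> (M <= kermx x^T)%MS.
  by split=> [?|/sub_kermxP//]; apply/sub_kermxP.
rewrite !k addsmx_sub genmxE; split=> [[h1 h2]|/andP[h1 h2]].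
  by apply/andP; split=> //; apply/k/dotv_eq0P/h1.
by split=> // _; apply/dotv_eq0P/k.
Qed.

Lemma znormals_cons p c :
  (znormals (p :: c) :=: if p.2 == None then p.1 + znormals c else znormals c)%MS.
Proof.
rewrite /znormals big_cons; case: ifP => _; last exact: eqmx_refl.
by apply: adds_eqmx; [exact: genmxE|exact: eqmx_refl].
Qed.

(** Double orthogonality: the columns of [cokermx] are points of the flat, so a form vanishing on
    the flat is killed by the cokernel of the span of the normals. *)
Lemma sub_znormalsP c b :
  (b <= znormals c)%MS <-> forall x, cell_flat c x -> dotv b x = 0.
Proof.
split=> [/submxP[D ->] x /cell_flatP h|h].
  by apply/dotv_eq0P; rewrite -mulmxA h mulmx0.
rewrite submxE; apply/eqP/trmx_inj; rewrite trmx0; apply/row_matrixP => i.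
rewrite row0 trmx_mul row_mul -[b^T]trmxK -[row i _]trmxK -trmx_mul.
rewrite trmxK; set x := row i _.
suff -> : b *m x^T = 0 by rewrite trmx0.
apply/dotv_eq0P/h/cell_flatP.
by rewrite /x -tr_col trmxK colE mulmxA mulmx_coker mul0mx.
Qed.

Lemma znormals_subP c c' :
  (znormals c <= znormals c')%MS <-> forall x, cell_flat c' x -> cell_flat c x.
Proof.
split=> [/submxP[D e] x /cell_flatP h|h]; first by apply/cell_flatP; rewrite e -mulmxA h mulmx0.
apply/row_subP => i; apply/sub_znormalsP => x /h /cell_flatP e.
by apply/dotv_eq0P; rewrite -row_mul e row0.
Qed.

Lemma eq_rank_znormals c c' : (forall x, cell_flat c x <-> cell_flat c' x) ->
  \rank (znormals c) = \rank (znormals c').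
Proof.
by move=> h; apply/eqP; rewrite eqn_leq !mxrankS //; apply/znormals_subP => x /h.
Qed.
End Cells.

(** * A combinatorial Euler characteristic and its additivity *)

Section Euler.
Variables (R : realType) (d : nat).
Notation V := 'rV[R]_d.
Notation constr := (V * option bool)%type.
Implicit Types (b x y : V) (c : seq constr).

Definition nonempty c := `[< exists x, cell c x >].

Lemma nonemptyP c : reflect (exists x, cell c x) (nonempty c).
Proof. exact: asboolP. Qed.

(* Otherwise unification unfolds distinct nonemptiness tests into one another. *)
Opaque nonempty.

(* Euler characteristic with compact support, up to the global sign (-1)^d. *)
Definition cell_sign c : int :=
  if nonempty c then (-1) ^+ \rank (znormals c) else 0.

Lemma eq_cell_sign c c' : c =i c' -> cell_sign c = cell_sign c'.
Proof.
move=> e; rewrite /cell_sign.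
have -> : nonempty c = nonempty c'.
  by apply/nonemptyP/nonemptyP => -[x h]; exists x => p pc; apply: h; rewrite ?e // -e.
congr (if _ then (-1) ^+ _ else 0); apply: eq_rank_znormals => x.
by split=> h p pc; apply: h; rewrite ?e // -e.
Qed.

Lemma rank_adds_row b (M : 'M[R]_d) : ~~ (b <= M)%MS ->
  \rank (b + M)%MS = (\rank M).+1.
Proof.
move=> nb; apply/eqP; rewrite eqn_leq; apply/andP; split.
  apply: leq_trans (mxrank_adds_leqif _ _) _.
  by have := rank_leq_row b; lia.
rewrite ltnNge; apply: contra nb => h.
have := mxrank_leqif_sup (addsmxSr b M) => -[_].
rewrite eqn_leq h mxrankS ?addsmxSr //= => /esym.
by rewrite addsmx_sub => /andP[].
Qed.

(* A linear form that does not vanish identically on a relatively open cell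
   either has constant sign on it, or cuts it into three cells. *)
Lemma cell_cut b c x : cell c x -> ~~ (b <= znormals c)%MS ->
  nonempty ((b, None) :: c) =
  nonempty ((b, Some true) :: c) &&
  nonempty ((b, Some false) :: c).
Proof.
move=> cx nb; apply/nonemptyP/andP.
  move=> [y /cell_cons[/= /sg3_0P y0 cy]].
  (* A direction inside the span of the cell that is transverse to the hyperplane; moving from [y]
     both ways along it reaches both sides. *)
  have [z fz bz] : exists2 z, cell_flat c z & dotv b z != 0.
    apply: contrapT => h; move/negP: nb; apply; apply/sub_znormalsP => z fz.
    by apply/eqP; apply: contrapT => /negP bz; apply: h; exists z.
  have [e e0 he] := cell_perturb cy fz.
  have h1 := he e; rewrite gtr0_norm // lexx in h1; have {}h1 := h1 isT.
  have h2 := he (- e); rewrite normrN gtr0_norm // lexx in h2; have {}h2 := h2 isT.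
  case: (ltrgt0P (dotv b z)) bz => // bz _; split; apply/nonemptyP.
  - exists (y + e *: z); apply/cell_cons; split=> //; apply/sg3_posP => /=.
    by rewrite dotvDr dotvZr y0 add0r mulr_gt0.
  - exists (y + - e *: z); apply/cell_cons; split=> //; apply/sg3_negP => /=.
    by rewrite dotvDr dotvZr y0 add0r mulNr oppr_lt0 mulr_gt0.
  - exists (y + - e *: z); apply/cell_cons; split=> //; apply/sg3_posP => /=.
    by rewrite dotvDr dotvZr y0 add0r mulNr oppr_gt0 pmulr_rlt0.
  - exists (y + e *: z); apply/cell_cons; split=> //; apply/sg3_negP => /=.
    by rewrite dotvDr dotvZr y0 add0r pmulr_rlt0.
case=> /nonemptyP[y /cell_cons[/= /sg3_posP y0 cy]] /nonemptyP[z /cell_cons[/= /sg3_negP z0 cz]].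
exists ((- dotv b z) *: y + dotv b y *: z); apply/cell_cons; split=> /=.
  by apply/sg3_0P; rewrite dotvDr !dotvZr mulNr mulrC addNr.
by apply: cell_convex; rewrite // oppr_gt0.
Qed.

Lemma cell_trichotomy b c x : cell c x ->
  [|| nonempty ((b, Some true) :: c),
      nonempty ((b, Some false) :: c) |
      nonempty ((b, None) :: c)].
Proof.
move=> cx; have : nonempty ((b, sg3 (dotv b x)) :: c).
  by apply/nonemptyP; exists x; apply/cell_cons.
by case: (sg3 _) => [[]|] ->; rewrite ?orbT.
Qed.

Lemma cell_sign_empty c : (~ exists x, cell c x) -> cell_sign c = 0.
Proof. by move=> h; rewrite /cell_sign; case: nonemptyP. Qed.

Lemma cell_sign_zero b c x : cell c x -> (b <= znormals c)%MS ->
  [/\ cell_sign ((b, None) :: c) = cell_sign c,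
      cell_sign ((b, Some true) :: c) = 0 &
      cell_sign ((b, Some false) :: c) = 0].
Proof.
move=> cx bc.
have bz y : cell c y -> dotv b y = 0.
  by move=> /cell_sub_flat; apply: (iffLR (sub_znormalsP c b)).
split; last 2 first.
- by apply: cell_sign_empty => -[y /cell_cons[/= /sg3_posP h /bz e]]; rewrite e ltxx in h.
- by apply: cell_sign_empty => -[y /cell_cons[/= /sg3_negP h /bz e]]; rewrite e ltxx in h.
rewrite /cell_sign !(introT (nonemptyP _)); last first.
- by exists x; apply/cell_cons; split=> //; apply/sg3_0P/bz.
- by exists x.
congr (_ ^+ _); rewrite znormals_cons /=.
by apply/eqP; rewrite eqn_leq !mxrankS ?addsmxSr // addsmx_sub bc submx_refl.
Qed.

Lemma cell_sign_cut b c s x : cell c x -> ~~ (b <= znormals c)%MS ->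
  cell_sign ((b, s) :: c) = if nonempty ((b, s) :: c)
    then cell_sign c * (if s is None then -1 else 1) else 0.
Proof.
move=> cx nb; rewrite /cell_sign; case: ifP => // _.
rewrite (introT (nonemptyP _)); last by exists x.
case: s => [s|]; first by rewrite mulr1 znormals_cons.
by rewrite znormals_cons /= rank_adds_row // exprSr.
Qed.

(** If [b] takes positive values on the cell, the negative and zero parts are both empty or, by
    [cell_cut], both nonempty with opposite signs. Otherwise the cell lies inside the hyperplane or
    strictly on its negative side, and one part is the whole cell. *)
Lemma cell_sign_le b c :
  cell_sign ((b, Some false) :: c) + cell_sign ((b, None) :: c) =
  if `[< forall x, cell c x -> dotv b x <= 0 >] then cell_sign c else 0.
Proof.
have [[x cx]|nc] := pselect (exists x, cell c x); last first.
  rewrite !cell_sign_empty // => [|[y /cell_cons[_ cy]]|[y /cell_cons[_ cy]]].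
  - by rewrite addr0 if_same.
  - by apply: nc; exists y.
  - by apply: nc; exists y.
have [bc|nb] := boolP (b <= znormals c)%MS.
  have [-> _ ->] := cell_sign_zero cx bc; rewrite add0r asboolT // => y cy.
  by rewrite (iffLR (sub_znormalsP c b) bc) //; apply: cell_sub_flat.
have -> : `[< forall y, cell c y -> dotv b y <= 0 >] = ~~ nonempty ((b, Some true) :: c).
  apply/asboolP/negP => [h /nonemptyP[y /cell_cons[/= /sg3_posP p /h]]|h y cy].
    by rewrite leNgt p.
  rewrite leNgt; apply/negP => p; apply: h; apply/nonemptyP; exists y; apply/cell_cons.
  by split=> //; apply/sg3_posP.
rewrite !(@cell_sign_cut _ _ _ x) //.
have := cell_trichotomy b cx; rewrite (cell_cut cx nb).
by case: (nonempty _); case: (nonempty _); rewrite //= ?mulrN1 ?mulr1 ?addrN ?addr0.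
Qed.

Lemma cell_sign_split b c :
  \sum_(s : option bool) cell_sign ((b, s) :: c) = cell_sign c.
Proof.
have -> : \sum_(s : option bool) cell_sign ((b, s) :: c) =
    cell_sign ((b, None) :: c) + (cell_sign ((b, Some true) :: c) +
    cell_sign ((b, Some false) :: c)).
  rewrite (bigD1 None) //= (bigD1 (Some true)) //= (bigD1 (Some false)) //=.
  by rewrite big1 ?addr0 // => -[[]|].
have [[x cx]|nc] := pselect (exists x, cell c x); last first.
  rewrite !cell_sign_empty // => -[y /cell_cons[_ cy]]; apply: nc; by exists y.
have [bc|nb] := boolP (b <= znormals c)%MS.
  by have [-> -> ->] := cell_sign_zero cx bc; rewrite !addr0.
rewrite !(@cell_sign_cut _ _ _ x) //.
have := cell_trichotomy b cx; rewrite (cell_cut cx nb).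
by case: (nonempty _); case: (nonempty _); rewrite //= ?mulrN1 ?mulr1 ?addKr ?addr0 ?add0r.
Qed.

Lemma sum_tuple_cons (T : finType) (M : nmodType) n (F : n.+1.-tuple T -> M) :
  \sum_t F t = \sum_s \sum_(t : n.-tuple T) F [tuple of s :: t].
Proof.
rewrite pair_big (reindex (fun p : T * n.-tuple T => [tuple of p.1 :: p.2])) //=.
exists (fun t => (thead t, [tuple of behead t])) => [[s t] _|t _] /=.
  by congr pair; apply: val_inj.
by rewrite [RHS]tuple_eta; apply: val_inj.
Qed.

Lemma sum_cell_sign_tuple n (bs : n.-tuple V) c :
  \sum_(t : n.-tuple (option bool)) cell_sign (zip bs t ++ c) = cell_sign c.
Proof.
elim: n bs => [|n IH] bs.
  rewrite (eq_bigr (fun=> cell_sign c)) => [|t _].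
    by rewrite sumr_const card_tuple expn0 mulr1n.
  by rewrite (tuple0 bs) (tuple0 t).
case/tupleP: bs => b bs; rewrite sum_tuple_cons exchange_big /= -[RHS](IH bs).
by apply: eq_bigr => t _; rewrite -[RHS](cell_sign_split b).
Qed.

Lemma sum_cell_sign n (a : 'I_n -> V) c :
  \sum_(s : {ffun 'I_n -> option bool})
    cell_sign ([seq (a i, s i) | i <- enum 'I_n] ++ c) = cell_sign c.
Proof.
rewrite -[RHS](sum_cell_sign_tuple [tuple a i | i < n]).
rewrite [RHS](reindex (fun s : {ffun 'I_n -> option bool} => [tuple s i | i < n])).
  apply: eq_bigr => s _; congr (cell_sign (_ ++ _)).
  by rewrite /= zip_map.
exists (fun t => [ffun i => tnth t i]) => [s _|t _].
  by apply/ffunP => i; rewrite ffunE tnth_mktuple.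
by apply: eq_from_tnth => i; rewrite tnth_mktuple ffunE.
Qed.

(** The parts [b < 0] and [b = 0] of the cell are refined separately by the family [a], then
    recombined inside each small cell by [cell_sign_le]. *)
Lemma sum_cell_sign_halfspace n (a : 'I_n -> V) b c :
  \sum_(s : {ffun 'I_n -> option bool})
    (let c' := [seq (a i, s i) | i <- enum 'I_n] ++ c in
     if `[< forall x, cell c' x -> dotv b x <= 0 >] then cell_sign c' else 0) =
  if `[< forall x, cell c x -> dotv b x <= 0 >] then cell_sign c else 0.
Proof.
rewrite -cell_sign_le -(sum_cell_sign a (_ :: c)) -(sum_cell_sign a ((b, None) :: c)).
rewrite -big_split; apply: eq_bigr => s _ /=; rewrite -cell_sign_le.
by congr (_ + _); apply: eq_cell_sign => p; rewrite !inE !mem_cat !inE orbCA.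
Qed.
End Euler.

(** * Dimension of spanning sets *)

Section Dims.
Variables (R : realType) (d : nat).

(** [X] need not be a subspace: finitely many of its points that span [W] are enough, so the lemma
    applies to cones as well as to flats. *)
Lemma dims_span (X : set 'rV[R]_d) m (W : 'M[R]_(m, d)) k (M : 'M[R]_(k, d)) :
  (forall x, X x -> (x <= W)%MS) -> (forall i, X (row i M)) -> (W <= M)%MS ->
  dims X = \rank W.
Proof.
move=> XW XM WM; rewrite /dims.
have le (j : 'I_d.+1) : `[< exists M : 'M[R]_(j, d),
    (forall i, X (row i M)) /\ row_free M >] -> (j <= \rank W)%N.
  move=> /asboolP[N [XN]]; rewrite /row_free => /eqP <-.
  by apply/mxrankS/row_subP => i; apply/XW/XN.
apply/eqP; rewrite eqn_leq; apply/andP; split; first exact/bigmax_leqP.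
have WleMd : (\rank W < d.+1)%N by rewrite ltnS rank_leq_col.
rewrite -[X in (X <= _)%N]/(nat_of_ord (Ordinal WleMd)).
apply: (@leq_bigmax_cond _ _ (fun i : 'I__ => nat_of_ord i)); apply/asboolP => /=.
have -> : \rank W = \rank M.
  apply/eqP; rewrite eqn_leq !mxrankS //; apply/row_subP => i; exact/XW.
exists (rowsub (maxrankfun M) M); split=> [i|].
  by rewrite row_rowsub.
exact: maxrowsub_free.
Qed.

Lemma dims_cell_flat (c : seq ('rV[R]_d * option bool)) :
  dims [set x | cell_flat c x] = (d - \rank (znormals c))%N.
Proof.
have kP (x : 'rV_d) : cell_flat c x <-> (x <= kermx (znormals c)^T)%MS.
  rewrite cell_flatP; split=> [h|/sub_kermxP h].
    by apply/sub_kermxP/trmx_inj; rewrite trmx_mul trmxK h trmx0.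
  by apply/trmx_inj; rewrite trmx_mul trmxK h trmx0.
rewrite (@dims_span _ _ (kermx (znormals c)^T) _ (kermx (znormals c)^T)) //.
- by rewrite mxrank_ker mxrank_tr.
- by move=> x /kP.
- by move=> i; apply/kP/row_sub.
Qed.
End Dims.

Lemma fsbig_finType (T : finType) (J : choiceType) (S : Type) (idx : S)
    (op : Monoid.com_law idx) (h : T -> J) (P : pred T) (Q : set J) (F : J -> S) :
  {in P &, injective h} -> (forall j, Q j <-> exists2 t, P t & h t = j) ->
  \big[op/idx]_(j \in Q) F j = \big[op/idx]_(t | P t) F (h t).
Proof.
move=> hinj QP; have -> : Q = h @` [set` enum P].
  apply/seteqP; split=> j.
    by move=> /QP[t Pt <-]; exists t => //=; rewrite mem_enum.
  by move=> [t /=]; rewrite mem_enum => Pt <-; apply/QP; exists t.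
rewrite fsbig_image; last first.
  by move=> s t; rewrite !inE /= !mem_enum; exact: hinj.
by rewrite -fsbig_seq ?enum_uniq // big_enum.
Qed.

(** * Faces as sign vectors, flats as zero sets *)

Section Arr.
Variables (R : realType) (d n : nat) (a : 'I_n -> 'rV[R]_d).
Notation V := 'rV[R]_d.
Notation signs := {ffun 'I_n -> option bool}.
Implicit Types (x y z : V) (s : signs) (Y Z : {set 'I_n}).

Definition hyp i : set V := [set x | dotv (a i) x = 0].
Definition arr : set (set V) := range hyp.
Definition sgv x : signs := [ffun i => sg3 (dotv (a i) x)].
Definition iscov s := `[< exists x, sgv x = s >].
Definition zset s : {set 'I_n} := finset (fun i => s i == None).
Definition fl Z : set V := [set x | forall i, i \in Z -> dotv (a i) x = 0].
Definition cstr s := [seq (a i, s i) | i <- enum 'I_n].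
Definition zcstr Z := [seq (a i, @None bool) | i <- enum Z].
Definition rkf Z := \rank (znormals (zcstr Z)).
(** The closed sets of the underlying matroid. On them [fl] is injective, whereas arbitrary index
    sets may define the same flat. *)
Definition isflat Z := `[< exists x, zset (sgv x) = Z >].

Lemma in_zset x i : (i \in zset (sgv x)) = (dotv (a i) x == 0).
Proof. by rewrite inE ffunE /sg3; case: (dotv _ _ == 0). Qed.

Lemma cell_cstr s x : cell (cstr s) x <-> sgv x = s.
Proof.
split=> [h|<- p /mapP[i _ ->] /=]; last by rewrite ffunE.
apply/ffunP => i; rewrite ffunE (h (a i, s i)) //.
by apply/mapP; exists i => //; rewrite mem_enum.
Qed.

Lemma cell_flat_cstr s x : cell_flat (cstr s) x <-> fl (zset s) x.
Proof.
split=> [h i|h p /mapP[i _ ->] /= si0]; last by apply: h; rewrite inE si0.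
rewrite inE => /eqP si0; apply: (h (a i, s i)) => //.
by apply/mapP; exists i => //; rewrite mem_enum.
Qed.

Lemma cell_flat_zcstr Z x : cell_flat (zcstr Z) x <-> fl Z x.
Proof.
split=> [h i iZ|h p /mapP[i + ->] _]; last by rewrite mem_enum; apply: h.
by apply: (h (a i, None)) => //; apply/mapP; exists i => //; rewrite mem_enum.
Qed.

Lemma cell_zcstr Z x : cell (zcstr Z) x <-> fl Z x.
Proof.
rewrite -cell_flat_zcstr; split; first exact: cell_sub_flat.
move=> h p pc; have /mapP[i _ e] := pc; rewrite e; apply/sg3_0P.
by move: (h p pc); rewrite e; apply.
Qed.

Lemma rank_cstr s : \rank (znormals (cstr s)) = rkf (zset s).
Proof.
by apply: eq_rank_znormals => x; rewrite cell_flat_zcstr cell_flat_cstr.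
Qed.

Lemma fl_setE Z : fl Z = [set x | cell_flat (zcstr Z) x].
Proof. by apply/seteqP; split=> x /cell_flat_zcstr. Qed.

Lemma rkf_le Z : (rkf Z <= d)%N.
Proof. exact: rank_leq_col. Qed.

Lemma dims_fl Z : dims (fl Z) = (d - rkf Z)%N.
Proof. by rewrite fl_setE dims_cell_flat. Qed.

Lemma codim_fl Z : codim (fl Z) = rkf Z.
Proof. by rewrite /codim dims_fl subKn ?rkf_le. Qed.

Lemma fl_subset Y Z : Y \subset Z -> fl Z `<=` fl Y.
Proof. by move=> /fintype.subsetP YZ x xZ i /YZ /xZ. Qed.

Lemma rkf_sub Y Z : fl Z `<=` fl Y -> (rkf Y <= rkf Z)%N.
Proof.
by move=> h; apply/mxrankS/znormals_subP => x /cell_flat_zcstr /h /cell_flat_zcstr.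
Qed.

Lemma rkf_lt Y Z : fl Z `<=` fl Y -> fl Z <> fl Y -> (rkf Y < rkf Z)%N.
Proof.
move=> h ne; rewrite ltn_neqAle rkf_sub // andbT; apply/eqP => e; apply: ne.
apply/seteqP; split=> //.
have sub : (znormals (zcstr Y) <= znormals (zcstr Z))%MS.
  by apply/znormals_subP => x /cell_flat_zcstr /h /cell_flat_zcstr.
have [_] := mxrank_leqif_sup sub; rewrite -/(rkf Y) -/(rkf Z) e eqxx => /esym.
by move=> /znormals_subP k x /cell_flat_zcstr /k /cell_flat_zcstr.
Qed.

Lemma fl_zset_refl x : fl (zset (sgv x)) x.
Proof. by move=> i; rewrite in_zset => /eqP. Qed.

Lemma fl_zset_sub x Z : fl (zset (sgv x)) `<=` fl Z <-> Z \subset zset (sgv x).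
Proof.
split=> [h|]; last exact: fl_subset.
by apply/fintype.subsetP => i iZ; rewrite in_zset; apply/eqP/(h x (@fl_zset_refl x) i iZ).
Qed.

Lemma fl_zset_inj x y : fl (zset (sgv x)) = fl (zset (sgv y)) ->
  zset (sgv x) = zset (sgv y).
Proof.
move=> e; apply/eqP; rewrite finset.eqEsubset; apply/andP.
by split; apply/fl_zset_sub; rewrite e.
Qed.

Lemma fl_setT : fl finset.setT = bot arr.
Proof.
apply/seteqP; split=> x h; first by move=> _ [i _ <-]; apply: h; rewrite finset.in_setT.
by move=> i _; apply: (h (hyp i)); exists i.
Qed.

Lemma zset_sgv0 : zset (sgv 0) = finset.setT.
Proof. by apply/setP => i; rewrite in_zset dotv0r eqxx finset.in_setT. Qed.

(** A subspace is not covered by finitely many proper subspaces. The forms are treated one by one: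
    if form [j] vanishes at [x] but not on the whole flat, a step along a [y] where it is nonzero
    repairs this, and the step is small enough to keep the earlier nonzero values. *)
Lemma generic_point Z : exists2 x, fl Z x &
  forall i, dotv (a i) x = 0 -> forall y, fl Z y -> dotv (a i) y = 0.
Proof.
suff [x xZ h] : exists2 x, fl Z x &
    forall i, i \in enum 'I_n -> dotv (a i) x = 0 -> forall y, fl Z y -> dotv (a i) y = 0.
  by exists x => // i; apply: h; rewrite mem_enum.
elim: (enum 'I_n) => [|j l [x xZ h]].
  by exists 0 => // i _; exact: dotv0r.
have [xj|xj] := pselect (dotv (a j) x = 0 -> forall y, fl Z y -> dotv (a j) y = 0).
  by exists x => // i; rewrite inE => /predU1P[->|/h].
have [xj0 /existsNP[y yj]] : dotv (a j) x = 0 /\ ~ forall y, fl Z y -> dotv (a j) y = 0.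
  by apply/not_implyP.
have [yZ yj0] : fl Z y /\ dotv (a j) y <> 0 by apply/not_implyP.
have [e e0 he] := sg3_perturb [seq a i | i <- enum 'I_n] x y.
have {}he := he e; rewrite gtr0_norm // lexx in he; have {}he := he isT.
exists (x + e *: y) => [i iZ|i].
  by rewrite dotvDr dotvZr xZ // yZ // mulr0 addr0.
rewrite inE => /predU1P[->|il].
  by move=> /eqP; rewrite dotvDr dotvZr xj0 add0r mulf_eq0 gt_eqF //= => /eqP.
have [x0 _|x0] := eqVneq (dotv (a i) x) 0; first exact: h.
move=> /sg3_0P; rewrite he //; first by move/sg3_0P => e1; rewrite e1 eqxx in x0.
by apply: map_f; rewrite mem_enum.
Qed.

Lemma fl_generic Z : exists x, fl (zset (sgv x)) = fl Z.
Proof.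
have [x xZ h] := generic_point Z; exists x; apply/seteqP; split=> y yx i.
  by move=> iZ; apply: yx; rewrite in_zset; apply/eqP/xZ.
by rewrite in_zset => /eqP /h; apply.
Qed.

Lemma flatP X : flat arr X <-> exists x, X = fl (zset (sgv x)).
Proof.
split=> [[S [SA ->]]|[x ->]].
  have [x h] := fl_generic (finset (fun i => `[< S (hyp i) >])).
  exists x; rewrite h; apply/seteqP; split=> y hy.
    by move=> i; rewrite inE => /asboolP /hy.
  move=> H SH; have [i _ e] := SA _ SH; rewrite -e; apply: hy.
  by rewrite inE; apply/asboolP; rewrite e.
exists (hyp @` [set i | i \in zset (sgv x)]); split=> [_ [i _ <-]|]; first by exists i.
apply/seteqP; split=> y hy; first by move=> _ [i ix <-]; exact: hy.
by move=> i ix; apply: (hy (hyp i)); exists i.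
Qed.

(** * The Möbius function as a count of faces in a half-space *)

Section Moebius.
Variable v : V.
Definition inneg s := `[< forall x, sgv x = s -> dotv v x <= 0 >].

(** The subspace [fl Z] is itself a cell, having only zero constraints; cutting it by the
    arrangement leaves the sign vectors whose zero set contains [Z]. *)
Lemma euler_flat Z :
  \sum_(s | [&& iscov s, Z \subset zset s & inneg s]) (-1) ^+ rkf (zset s) =
  if `[< forall x, fl Z x -> dotv v x <= 0 >] then (-1) ^+ rkf Z else 0 :> int.
Proof.
have := sum_cell_sign_halfspace a v (zcstr Z).
have -> : (forall x, cell (zcstr Z) x -> dotv v x <= 0) = forall x, fl Z x -> dotv v x <= 0.
  by apply/propext; split=> h x /cell_zcstr; exact: h.
have -> : cell_sign (zcstr Z) = (-1) ^+ rkf Z.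
  rewrite /cell_sign (introT (nonemptyP _)) //.
  by exists 0; apply/cell_zcstr => i _; exact: dotv0r.
move=> <-; rewrite big_mkcond; apply: eq_bigr => s _ /=; rewrite -/(cstr s).
have cellE x : cell (cstr s ++ zcstr Z) x <-> sgv x = s /\ Z \subset zset s.
  split=> [h|[sx Zs] p].
    have sx : sgv x = s.
      by apply/cell_cstr => p pc; apply: h; rewrite mem_cat pc.
    split=> //; rewrite -sx; apply/fintype.subsetP => i iZ; rewrite in_zset; apply/eqP.
    have /cell_zcstr : cell (zcstr Z) x by move=> p pc; apply: h; rewrite mem_cat pc orbT.
    exact.
  rewrite mem_cat => /orP[]; first exact: (iffRL (cell_cstr s x) sx).
  apply: (iffRL (cell_zcstr Z x)); apply: (fl_subset Zs).
  by rewrite -sx; exact: fl_zset_refl.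
have [/andP[/asboolP[x sx] Zs]|ncov] := boolP (iscov s && (Z \subset zset s)); last first.
  rewrite cell_sign_empty ?if_same; last first.
    move=> [x /cellE[sx Zs]]; move: ncov; rewrite Zs andbT => /asboolP; apply.
    by exists x.
  by rewrite andbA (negbTE ncov).
have -> : iscov s by apply/asboolP; exists x.
rewrite Zs /= /inneg; congr (if `[< _ >] then _ else 0).
  by apply/propext; split=> h y; [case/cellE=> /h|move=> sy; apply: h; apply/cellE].
rewrite /cell_sign (introT (nonemptyP _)); last by exists x; apply/cellE.
rewrite -rank_cstr; congr (_ ^+ _); apply: eq_rank_znormals => y.
split=> [/cell_flat_cstr ys p|h p pc e]; last by apply: h; rewrite // mem_cat pc.
rewrite mem_cat => /orP[] pc e; first exact: (iffRL (cell_flat_cstr s y) ys).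
by apply: (iffRL (cell_flat_zcstr Z y) (fl_subset Zs ys)).
Qed.

Hypothesis gen_v : generic_hyperplane arr (orth v).

Definition ncov Z := #|[pred s | [&& iscov s, inneg s & zset s == Z]]|.

Lemma bot_orth x : fl finset.setT x -> dotv v x = 0.
Proof. by rewrite fl_setT dotvC => h; case: gen_v => _ [sub _]; apply: sub. Qed.

(** A linear form of constant sign on a subspace vanishes there, and by genericity [bot] is the only
    flat inside [orth v]. *)
Lemma fl_neg_bot Z : (forall x, fl Z x -> dotv v x <= 0) -> fl Z = bot arr.
Proof.
move=> h; case: gen_v => _ [_ g]; apply: g.
  by apply/flatP; have [x <-] := fl_generic Z; exists x.
move=> x xZ; rewrite /orth /= dotvC; apply/eqP; rewrite eq_le h //= -oppr_le0 -dotvNr.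
by apply: h => i iZ; rewrite dotvNr xZ // oppr0.
Qed.

Lemma ncov_setT : ncov finset.setT = 1%N.
Proof.
rewrite /ncov (eq_card (_ : _ =i pred1 (sgv 0))) ?card1 // => s; rewrite !inE.
apply/idP/eqP => [/and3P[_ _ /eqP sT]|->].
  apply/ffunP => i; have : i \in zset s by rewrite sT finset.in_setT.
  by rewrite inE => /eqP ->; rewrite ffunE dotv0r /sg3 eqxx.
rewrite zset_sgv0 eqxx andbT; apply/andP; split; first by apply/asboolP; exists 0.
apply/asboolP => y sy; rewrite bot_orth // => i _; apply/eqP.
by rewrite -in_zset sy in_zset dotv0r.
Qed.

Lemma sum_subflats Z : fl Z <> bot arr ->
  \sum_(s | [&& iscov s, inneg s & Z \proper zset s]) (-1) ^+ rkf (zset s) =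
  - ((-1) ^+ rkf Z * (ncov Z)%:R) :> int.
Proof.
move=> ne; have := euler_flat Z; rewrite asboolF; last by move/fl_neg_bot.
rewrite (bigID (fun s => zset s == Z)) /= addrC => /eqP; rewrite addr_eq0 => /eqP eul.
transitivity (\sum_(s | [&& iscov s, Z \subset zset s & inneg s] && (zset s != Z))
    (-1) ^+ rkf (zset s) : int).
  apply: eq_bigl => s; rewrite finset.properEneq eq_sym.
  by case: (iscov s); case: (inneg s); case: (_ \subset _); case: (_ == _).
rewrite eul; congr (- _).
rewrite /ncov -sum1_card natr_sum mulr_sumr; apply: eq_big => [s|s /andP[_ /eqP ->]].
  rewrite !inE; case: eqP => [->|]; rewrite ?andbF // fintype.subxx /=.
  by rewrite !andbT.
by rewrite mulr1.
Qed.

(** The signed count of faces in [sum_subflats] is exactly the defining recursion of the Möbius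
    function; smaller flats have larger zero sets. Each recursive call increases [rkf], so the rank
    gap to [bot] is what the fuel has to exceed. *)
Lemma mob_fuelE k x : let Z := zset (sgv x) in
  (rkf finset.setT - rkf Z < k)%N ->
  mob_fuel arr k (fl Z) = (-1) ^+ (rkf finset.setT + rkf Z) * (ncov Z)%:R.
Proof.
elim: k x => [|k IH] x Z //; rewrite /= => lk; case: asboolP => [e|ne].
  have ZT : Z = finset.setT.
    by rewrite -zset_sgv0; apply: fl_zset_inj; rewrite zset_sgv0 fl_setT.
  by rewrite ZT ncov_setT mulr1 -signr_odd oddD addbb.
rewrite (@fsbig_finType _ _ _ _ _ fl (fun Y => isflat Y && (Z \proper Y))); first last.
- move=> Y; split=> [[/flatP[y ->] [_ lt]]|[W /andP[/asboolP[y yW] ZW] <-]].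
    exists (zset (sgv y)) => //; apply/andP; split; first by apply/asboolP; exists y.
    rewrite finset.properEneq; apply/andP; split; last exact/fl_zset_sub/(proj1 lt).
    by apply/eqP => e; move: lt; rewrite -e => -[_]; apply.
  split; first by apply/flatP; exists y; rewrite yW.
  split; first by rewrite -fl_setT; apply: fl_subset; exact: finset.subsetT.
  split; first exact/fl_subset/proper_sub.
  have /fintype.properP[_ [i iW iZ]] := ZW.
  move=> /(_ x (@fl_zset_refl x)) /(_ i iW) /eqP; rewrite -in_zset; exact/negP.
- move=> Y W /andP[/asboolP[y <-] _] /andP[/asboolP[w <-] _]; exact: fl_zset_inj.
(* Each Möbius value is expanded as a signed count of faces, to merge the double sum into one over
   all faces strictly inside the flat. *)
rewrite (eq_bigr (fun Y => \sum_(s | [&& iscov s, inneg s & Z \proper zset s] && (zset s == Y))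
    (-1) ^+ (rkf finset.setT + rkf (zset s)))); last first.
  move=> W /andP[/asboolP[y yW] ZW]; rewrite -yW IH; last first.
    suff : (rkf Z < rkf W <= rkf finset.setT)%N by rewrite yW; lia.
    rewrite rkf_sub ?rkf_lt //; first exact/fl_subset/proper_sub.
      by rewrite -yW => /fl_zset_inj e; move: ZW; rewrite -yW e fintype.properxx.
    exact/fl_subset/finset.subsetT.
  rewrite yW /ncov -sum1_card natr_sum mulr_sumr.
  rewrite [RHS](eq_bigl (fun s => s \in [pred s | [&& iscov s, inneg s & zset s == W]])); last first.
    by move=> s; rewrite !inE; case: eqP => [->|]; rewrite ?ZW ?andbT ?andbF.
  by apply: eq_bigr => s; rewrite inE => /and3P[_ _ /eqP ->]; rewrite mulr1.
rewrite -(partition_big zset) /=; last first.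
  by move=> s /and3P[/asboolP[y <-] _ ->]; rewrite andbT; apply/asboolP; exists y.
under eq_bigr do rewrite exprD.
by rewrite -mulr_sumr sum_subflats // mulrN opprK exprD mulrA.
Qed.

Lemma arr_polyE :
  arr_poly arr = \sum_(s | iscov s && inneg s) ('X - 1) ^+ rkf (zset s).
Proof.
rewrite /arr_poly (@fsbig_finType _ _ _ _ _ fl isflat); first last.
- move=> Y; split=> [/flatP[y ->]|[W /asboolP[y <-] <-]]; last by apply/flatP; exists y.
  by exists (zset (sgv y)) => //; apply/asboolP; exists y.
- by move=> Y W /asboolP[y <-] /asboolP[w <-]; exact: fl_zset_inj.
rewrite [RHS](partition_big zset isflat) /=; last first.
  by move=> s /andP[/asboolP[y <-] _]; apply/asboolP; exists y.
apply: eq_bigr => Z /asboolP[x xZ]; rewrite codim_fl.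
rewrite (eq_bigr (fun=> ('X - 1) ^+ rkf Z)); last by move=> s /andP[_ /eqP ->].
rewrite sumr_const -mulr_natl /mobius -xZ mob_fuelE; last first.
  by rewrite ltnS; apply: leq_trans (leq_subr _ _) (rkf_le _).
rewrite normrM normrX normrN1 expr1n mul1r normr_nat; congr (_ * _).
rewrite polyCMn; congr (_ *+ _); by apply: eq_card => s; rewrite !inE andbA.
Qed.

End Moebius.
End Arr.

(** * Continuity of linear forms and of lines *)

Section Continuity.
Variables (R : realType) (d : nat).

Lemma dotv_continuous (b : 'rV[R]_d) : continuous (dotv b).
Proof.
move=> x; rewrite /dotv; elim: (index_enum _) => [|i r IH].
  have -> : (fun y : 'rV[R]_d => \sum_(i <- [::]) b ord0 i * y ord0 i) = cst 0.
    by apply/funext => y; rewrite big_nil.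
  exact: cst_continuous.
have -> : (fun y : 'rV[R]_d => \sum_(k <- i :: r) b ord0 k * y ord0 k) =
    (fun y => b ord0 i * y ord0 i + \sum_(k <- r) b ord0 k * y ord0 k).
  by apply/funext => y; rewrite big_cons.
have c1 := @continuousM _ _ (cst (b ord0 i)) _ x (@cst_continuous _ _ _ x)
  (@coord_continuous R 1 d ord0 i x).
exact: (cvgD c1 IH).
Qed.

Lemma line_continuous (x y : 'rV[R]_d) : continuous (fun t : R => x + t *: y).
Proof.
move=> t; apply/cvg_ballP => e e0.
have h := @filter_forall _ 'I_d
  (fun j u => ball ((x + t *: y) ord0 j) e ((x + u *: y) ord0 j)) (nbhs t)
  (nbhs_filter t).
apply: filterS (h _) => [u hu|j].
  by split=> // i j; rewrite ord1; exact: hu.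
have : (fun u : R => x ord0 j + u * y ord0 j) u @[u --> t] --> x ord0 j + t * y ord0 j.
  have ci : {for t, continuous (fun u : R => u)} by exact: cvg_id.
  have c1 : {for t, continuous (fun u : R => u * y ord0 j)}.
    exact: (continuousM ci (@cst_continuous _ _ _ t)).
  exact: (cvgD (@cst_continuous _ _ (x ord0 j) t) c1).
by move=> /cvg_ballP /(_ e e0); apply: filterS => u; rewrite !mxE.
Qed.
End Continuity.

(** * Topological faces and regions are closed sign cells *)

Section ClosedCells.
Variables (R : realType) (d n : nat) (a : 'I_n -> 'rV[R]_d).
Notation V := 'rV[R]_d.
Notation sgv := (sgv a).
Notation arr := (arr a).
Notation fl := (fl a).
Notation rkf := (rkf a).
Implicit Types (x y z : V).

(* The closure of the face containing [x]. *)
Definition ccell x : set V := [set y | forall i,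
  (dotv (a i) x = 0 -> dotv (a i) y = 0) /\ 0 <= dotv (a i) x * dotv (a i) y].

Definition regular x := forall i, dotv (a i) x <> 0.

Lemma sgv_eqP x y : sgv x = sgv y <->
  forall i, sg3 (dotv (a i) x) = sg3 (dotv (a i) y).
Proof.
split=> [/ffunP h i|h]; first by have := h i; rewrite !ffunE.
by apply/ffunP => i; rewrite !ffunE.
Qed.

Lemma ccell_refl x : ccell x x.
Proof. by move=> i; split=> //; exact: sqr_ge0. Qed.

Lemma ccell_trans x y : ccell x y -> ccell y `<=` ccell x.
Proof.
move=> xy z yz i; have [h1 h2] := xy i; have [h3 h4] := yz i.
split=> [/h1/h3//|].
move: h1 h2 h3 h4; set p := dotv _ x; set q := dotv _ y; set r := dotv _ z => h1 h2 h3 h4.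
have [q0|q0] := eqVneq q 0; first by rewrite h3 // mulr0.
by case: (ltrgt0P q) q0 => // q0 _; nra.
Qed.

Lemma ccell_anti x y : ccell x y -> ccell y x -> sgv x = sgv y.
Proof.
move=> xy yx; apply/sgv_eqP => i; have [h1 h2] := xy i; have [h3 _] := yx i.
move: h1 h2 h3; set p := dotv _ x; set q := dotv _ y => h1 h2 h3.
case: (sg3P p) => [p0|p0|/h1 ->]; last by apply/esym/sg3_0P.
  apply/esym/sg3_posP; rewrite lt_def; apply/andP; split; last by nra.
  by apply/eqP => /h3 p00; rewrite p00 ltxx in p0.
apply/esym/sg3_negP; rewrite lt_def; apply/andP; split; last by nra.
by apply/eqP => /esym /h3 p00; rewrite p00 ltxx in p0.
Qed.

Lemma ccell_sgv x y : sgv x = sgv y -> ccell x y.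
Proof.
move=> /sgv_eqP h i; have := h i.
case: (sg3P (dotv (a i) x)) => [p0 /esym/sg3_posP|p0 /esym/sg3_negP|-> /esym/sg3_0P ->]; last by rewrite mul0r.
  by move=> q0; split; [move=> e; rewrite e ltxx in p0|nra].
by move=> q0; split; [move=> e; rewrite e ltxx in p0|nra].
Qed.

Lemma ccell_eqP x y : ccell x = ccell y <-> sgv x = sgv y.
Proof.
split=> [e|e]; last by apply/seteqP; split; apply/ccell_trans/ccell_sgv.
by apply: ccell_anti; [rewrite e|rewrite -e]; exact: ccell_refl.
Qed.

Lemma ccell_add x y s t : 0 <= s -> 0 <= t ->
  forall z, ccell z x -> ccell z y -> ccell z (s *: x + t *: y).
Proof.
move=> s0 t0 z zx zy i; have [h1 h2] := zx i; have [h3 h4] := zy i.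
rewrite dotvDr !dotvZr; split=> [z0|]; first by rewrite h1 // h3 // !mulr0 addr0.
by rewrite mulrDr !(mulrCA (dotv (a i) z)) addr_ge0 // mulr_ge0.
Qed.

Lemma ccell_perturb x y t : ccell x y -> 0 < t -> sgv (y + t *: x) = sgv x.
Proof.
move=> xy t0; apply/sgv_eqP => i; have [h1 h2] := xy i; rewrite dotvDr dotvZr.
move: h1 h2; set p := dotv _ x; set q := dotv _ y => h1 h2.
case: (sg3P p) => [p0|p0|p0].
- by apply/sg3_posP; rewrite ltr_wpDl ?mulr_gt0 //; nra.
- apply/sg3_negP; suff : q <= 0 /\ t * p < 0 by lra.
  by split; [nra|rewrite pmulr_rlt0].
- by apply/sg3_0P; rewrite h1 // p0 mulr0 addr0.
Qed.

(** On a connected set with constant zero set, each form is identically zero or has an interval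
    avoiding zero as image, so signs are constant. Conversely a sign class is convex, hence joined
    by segments. *)
Lemma component_sgv x :
  connected_component [set y | zset (sgv y) = zset (sgv x)] x = [set y | sgv y = sgv x].
Proof.
apply/seteqP; split=> y.
  move=> [B [Bx BS Bc By]]; apply/sgv_eqP => i.
  have eq0 z : B z -> (dotv (a i) z == 0) = (dotv (a i) x == 0).
    by move=> /BS /setP /(_ i); rewrite !in_zset.
  have /connected_intervalP itv : connected (dotv (a i) @` B).
    apply: connected_continuous_connected => //.
    exact/continuous_subspaceT/dotv_continuous.
  have [x0|x0] := eqVneq (dotv (a i) x) 0.
    by rewrite x0; congr sg3; apply/eqP; rewrite eq0 // x0.
  have y0 : dotv (a i) y != 0 by rewrite eq0.
  have no0 : ~ (dotv (a i) @` B) 0.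
    by move=> [z Bz /eqP]; rewrite eq0 // (negbTE x0).
  have Ix : (dotv (a i) @` B) (dotv (a i) x) by exists x.
  have Iy : (dotv (a i) @` B) (dotv (a i) y) by exists y.
  case: (sg3P (dotv (a i) x)) x0 => [p0|p0|->]; rewrite ?eqxx // => _;
    case: (sg3P (dotv (a i) y)) y0 => [q0|q0|->]; rewrite ?eqxx // => _;
    exfalso; apply: no0; first [by apply: (itv _ _ Ix Iy); rewrite !ltW|by apply: (itv _ _ Iy Ix); rewrite !ltW].
move=> /= e; exists ((fun t : R => x + t *: (y - x)) @` `[0, 1]); last first.
  exists 1; first by rewrite /= in_itv /= ler01 lexx.
  by rewrite scale1r addrC subrK.
split.
- exists 0; first by rewrite /= in_itv /= ler01 lexx.
  by rewrite scale0r addr0.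
- move=> _ [t /= /itvP t01 <-]; suff -> : sgv (x + t *: (y - x)) = sgv x by [].
  (* Away from [t = 1] the point is [t *: y] plus a positive multiple of [x], the form that
     [ccell_perturb] accepts. *)
  have [->|t1] := eqVneq t 1; first by rewrite scale1r addrC subrK.
  have -> : x + t *: (y - x) = t *: y + (1 - t) *: x.
    by rewrite scalerBr scalerBl scale1r addrCA addrA.
  apply: ccell_perturb; last by rewrite subr_gt0 lt_neqAle t1 t01.
  rewrite -[t *: y]addr0 -(scale0r y); apply: ccell_add; rewrite ?t01 //;
    exact/ccell_sgv.
- apply: connected_continuous_connected; first exact: segment_connected.
  exact/continuous_subspaceT/line_continuous.
Qed.

(** The conditions of [ccell] are closed, and a point [y] satisfying them is the limit of the points
    [y + t *: x], [t > 0], of the open face. *)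
Lemma closure_component x :
  closure (connected_component [set y | zset (sgv y) = zset (sgv x)] x) = ccell x.
Proof.
rewrite component_sgv; apply/seteqP; split=> y.
  move=> cy i; split=> [x0|].
    have cl := @preimage_closed _ _ (dotv (a i)) [set r | r = 0].
    apply: (cl _ (@closed_eq R 0)) => [z _|]; first exact: dotv_continuous.
    move: cy; apply: closure_subset => z /sgv_eqP /(_ i); rewrite x0 /=.
    by move=> e; apply/sg3_0P; rewrite e; apply/sg3_0P.
  rewrite -dotvZl.
  have cl := @preimage_closed _ _ (dotv (dotv (a i) x *: a i)) [set r | 0 <= r].
  apply: (cl _ (@closed_ge R 0)) => [z _|]; first exact: dotv_continuous.
  move: cy; apply: closure_subset => z /= /esym /ccell_sgv /(_ i)[_].
  by rewrite dotvZl.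
move=> xy B; have := @line_continuous R d y x 0; rewrite /continuous_at scale0r addr0.
move=> h /h /nbhs_ballP[e /= e0 he].
exists (y + (e / 2) *: x); split.
  by apply: ccell_perturb => //; rewrite divr_gt0.
apply: he; rewrite /ball /= sub0r normrN gtr0_norm ?divr_gt0 //.
by rewrite ltr_pdivrMr // ltr_pMr // ltr1n.
Qed.

Lemma zset_regular x : regular x <-> zset (sgv x) = finset.set0.
Proof.
split=> [h|/setP h i]; first by apply/setP => i; rewrite in_zset finset.in_set0; apply/eqP.
by have := h i; rewrite in_zset finset.in_set0 => /eqP.
Qed.

Lemma faceP F : face arr F <-> exists x, F = ccell x.
Proof.
(* Removing from a flat the hyperplanes that do not contain it leaves the points with exactly that
   zero set. *)
have SE x : fl (zset (sgv x)) `\` \bigcup_(H in [set H | arr H /\ ~ (fl (zset (sgv x)) `<=` H)]) H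
    = [set y | zset (sgv y) = zset (sgv x)].
  apply/seteqP; split=> y /=.
    move=> [yx ny]; apply/setP => i; apply/idP/idP; rewrite !in_zset; last first.
      by move=> xi; apply/eqP/yx; rewrite in_zset.
    move=> /eqP yi; rewrite -in_zset; apply: contrapT => xi; apply: ny; exists (hyp a i) => //.
    split; first by exists i.
    move=> /(_ x (@fl_zset_refl _ _ _ a x)) /eqP; rewrite -in_zset //.
  move=> e; split; first by rewrite -e; exact: fl_zset_refl.
  move=> [_ [[i _ <-] h] yi]; apply: h => z zx; apply: zx.
  by rewrite -e in_zset; apply/eqP.
split=> [[X [x [/flatP[z ->]]]]|[x ->]].
  rewrite SE => -[/= e ->]; by exists x; rewrite -e closure_component.
exists (fl (zset (sgv x))), x; split; first by apply/flatP; exists x.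
by rewrite SE; split=> //; rewrite closure_component.
Qed.

Lemma regionP C : region arr C <-> exists2 x, regular x & C = ccell x.
Proof.
have SE : arr_complement arr = [set y | zset (sgv y) = finset.set0].
  apply/seteqP; split=> y /=.
    move=> h; apply/zset_regular => i yi; apply: h; exists (hyp a i) => //; by exists i.
  by move=> /zset_regular h [_ [i _ <-]]; exact: h.
split=> [[x []]|[x /zset_regular rx ->]].
  by rewrite SE => /= rx ->; exists x; [apply/zset_regular|rewrite -rx closure_component].
by exists x; rewrite SE -closure_component rx.
Qed.

Definition flmx Z : 'M[R]_d := kermx (znormals (zcstr a Z))^T.

Lemma flmxP Z y : fl Z y <-> (y <= flmx Z)%MS.
Proof.
rewrite -cell_flat_zcstr cell_flatP; split=> [h|/sub_kermxP h].
  by apply/sub_kermxP/trmx_inj; rewrite trmx_mul trmxK h trmx0.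
by apply/trmx_inj; rewrite trmx_mul trmxK h trmx0.
Qed.

Lemma rank_flmx Z : \rank (flmx Z) = (d - rkf Z)%N.
Proof. by rewrite mxrank_ker mxrank_tr. Qed.

(** A face is relatively open in its flat: it contains [x] and a small nonzero step from [x] along
    each row of [W], and these points span the flat. *)
Lemma dims_ccell x : dims (ccell x) = (d - rkf (zset (sgv x)))%N.
Proof.
have sub : ccell x `<=` fl (zset (sgv x)).
  by move=> y xy i; rewrite in_zset => /eqP /(xy i).1.
rewrite -dims_fl; set Z := zset (sgv x).
pose W := flmx Z; have kP y : fl Z y <-> (y <= W)%MS by exact: flmxP.
rewrite (@dims_span _ _ (fl Z) _ W _ W) //; first last.
- by move=> i; apply/kP/row_sub.
- by move=> y /kP.
have pt (j : 'I_d) : exists2 e, e != 0 & sgv (x + e *: row j W) = sgv x.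
  have /kP Wj := row_sub j W.
  have cx : cell (cstr a (sgv x)) x by apply/cell_cstr.
  have [|e e0 he] := @cell_perturb _ _ _ _ (row j W) cx; first by apply/cell_flat_cstr.
  by exists e; [rewrite gt_eqF|apply/cell_cstr/he; rewrite gtr0_norm].
have [e he0 he] : exists2 e : 'I_d -> R, (forall j, e j != 0) &
    forall j, sgv (x + e j *: row j W) = sgv x.
  have [e he] := choice (fun j => (let: ex_intro2 e e1 e2 := pt j in ex_intro _ e (conj e1 e2))).
  by exists e => j; case: (he j).
rewrite (@dims_span _ _ (ccell x) _ W _ (col_mx x (\matrix_j (x + e j *: row j W)))) //.
- by move=> y /sub /kP.
- move=> i; rewrite -[i]splitK; case: (fintype.split i) => k /=.
    by rewrite rowKu row_id ?ord1; exact: ccell_refl.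
  by rewrite rowKd rowK; apply: ccell_sgv; rewrite he.
apply/row_subP => j; set M := col_mx _ _.
have xM : (x <= M)%MS by rewrite -addsmxE addsmxSl.
have : ((x + e j *: row j W)%R <= M)%MS.
  apply: submx_trans (_ : (\matrix_j (x + e j *: row j W)%R <= M)%MS); last by rewrite -addsmxE addsmxSr.
  by rewrite -[X in (X <= _)%MS](rowK (fun j => x + e j *: row j W)) row_sub.
move=> h; rewrite -[row j W](scalerK (he0 j)) scalemx_sub //.
rewrite -[e j *: _](addKr x) addmx_sub // ?eqmx_opp //.
Qed.

End ClosedCells.

(** * Rays of a region and the walls opposite to them *)

Section SimplicialCones.
Variables (R : realType) (d n : nat) (a : 'I_n -> 'rV[R]_d).
Notation V := 'rV[R]_d.
Notation sgv := (sgv a).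
Notation arr := (arr a).
Notation fl := (fl a).
Notation rkf := (rkf a).
Notation ccell := (ccell a).
Notation regular := (regular a).
Notation top := ([set: 'I_n]%SET).
Implicit Types (x y z : V) (Z : {set 'I_n}).

Lemma rkf_setU1 i Z : (rkf (i |: Z) <= (rkf Z).+1)%N.
Proof.
have -> : rkf (i |: Z)%SET = \rank (znormals ((a i, None) :: zcstr a Z)).
  apply: eq_rank_znormals => x; rewrite cell_flat_zcstr; split=> [h p|h j].
    rewrite inE => /predU1P[-> _|]; first by apply: h; rewrite !inE eqxx.
    have : cell_flat (zcstr a Z) x.
      by apply/cell_flat_zcstr => j jZ; apply: h; rewrite !inE jZ orbT.
    exact.
  rewrite !inE => /predU1P[->|jZ]; first by apply: (h (a i, None)); rewrite ?inE ?eqxx.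
  apply: (h (a j, None)) => //; rewrite inE; apply/orP; right.
  by apply/mapP; exists j; rewrite // mem_enum.
rewrite znormals_cons /=; apply: leq_trans (mxrank_adds_leqif _ _) _.
by have := rank_leq_row (a i); rewrite /rkf; lia.
Qed.

Lemma arr_rankE : arr_rank arr = rkf top.
Proof. by rewrite /arr_rank -fl_setT dims_fl subKn ?rkf_le. Qed.

Lemma face_rank_ccell x : face_rank arr (ccell x) = (rkf top - rkf (zset (sgv x)))%N.
Proof.
rewrite /face_rank dims_ccell -fl_setT dims_fl.
have := rkf_le a top; have := rkf_le a (zset (sgv x)); lia.
Qed.

(** The span of such a face is a line modulo [bot]: after subtracting the multiple of [x] that kills
    one form nonzero at [x], the rank is that of [bot]. *)
Lemma face_rank1_ray x z : face_rank arr (ccell x) = 1%N ->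
  fl (zset (sgv x)) z -> exists c, forall i, dotv (a i) z = c * dotv (a i) x.
Proof.
rewrite face_rank_ccell; set Z := zset _ => r1 zx.
have [i0 xi0] : exists i, dotv (a i) x != 0.
  apply: contrapT => h; move: r1; suff -> : Z = top by rewrite subnn.
  apply/setP => i; rewrite in_zset finset.in_setT; apply/eqP/eqP.
  by apply: contrapT => /negP xi; apply: h; exists i.
pose c := dotv (a i0) z / dotv (a i0) x; exists c => i.
pose w := z - c *: x; suff : fl top w.
  by move=> /(_ i); rewrite finset.in_setT dotvBr dotvZr => /(_ isT) /eqP; rewrite subr_eq0 => /eqP.
have wZ : fl (i0 |: Z)%SET w.
  move=> j; rewrite !inE dotvBr dotvZr => /predU1P[->|].
    by rewrite /c divfK // subrr.
  rewrite -/(zset _) => jZ; rewrite zx ?(@fl_zset_refl _ _ _ a x) ?mulr0 ?subrr //.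
    by rewrite inE.
  by rewrite inE.
have lt : (rkf Z < rkf (i0 |: Z)%SET)%N.
  apply: rkf_lt; first exact/fl_subset/finset.subsetUr.
  move=> /seteqP[_ h]; move/eqP: xi0; apply.
  by apply: (h x (@fl_zset_refl _ _ _ a x)); rewrite !inE eqxx.
suff <- : fl (i0 |: Z)%SET = fl top by [].
apply: contrapT => /nesym ne; have := rkf_lt (fl_subset (finset.subsetT _)) ne; lia.
Qed.

(** The rank is at least two, so one more equation still leaves a flat above [bot]. The point [y] is
    the direction along which [minkowski_rays] splits [x]. *)
Lemma face_rank_neq1 x : face_rank arr (ccell x) != 1%N -> ~ fl top x ->
  exists i0 y, [/\ dotv (a i0) x != 0, dotv (a i0) y = 0,
    fl (zset (sgv x)) y & ~ fl top y].
Proof.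
rewrite face_rank_ccell; set Z := zset _ => r1 nx.
have [i0 xi0] : exists i, dotv (a i) x != 0.
  apply: contrapT => h; apply: nx => i _; apply/eqP.
  by apply: contrapT => /negP xi; apply: h; exists i.
exists i0; apply: contrapT => h.
have ltx : (rkf Z < rkf top)%N.
  apply: rkf_lt; first exact/fl_subset/finset.subsetT.
  by move=> e; apply: nx; rewrite e; exact: fl_zset_refl.
suff e : fl (i0 |: Z)%SET = fl top.
  have := rkf_setU1 i0 Z; suff -> : rkf (i0 |: Z)%SET = rkf top by lia.
  by apply/eqP; rewrite eqn_leq !rkf_sub // e.
apply/seteqP; split; last exact/fl_subset/finset.subsetT.
move=> y yZ; apply: contrapT => ny; apply: h; exists y; split=> //.
  by apply: yZ; rewrite !inE eqxx.
by apply: fl_subset yZ; exact: finset.subsetUr.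
Qed.

(** Equality is tested by the forms [a i] only, that is, modulo [bot]. *)
Definition nonneg_comb r (rho : 'I_r -> V) x := exists2 c : 'I_r -> R,
  forall k, 0 <= c k & forall i, dotv (a i) x = \sum_k c k * dotv (a i) (rho k).

Lemma nonneg_comb_add r (rho : 'I_r -> V) x y z t : 0 < t ->
  (forall i, t * dotv (a i) z = dotv (a i) x + dotv (a i) y) ->
  nonneg_comb rho x -> nonneg_comb rho y -> nonneg_comb rho z.
Proof.
move=> t0 e [c c0 cx] [c' c'0 cy]; exists (fun k => t^-1 * (c k + c' k)) => [k|i].
  by rewrite mulr_ge0 ?invr_ge0 ?addr_ge0 // ltW.
apply: (mulfI (lt0r_neq0 t0)); rewrite e cx cy -big_split mulr_sumr /=.
apply: eq_bigr => k _; rewrite mulrA mulrA divff ?gt_eqF // mul1r mulrDl.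
by [].
Qed.

(* With [t0] and [t1] the extreme values of [<a_i,y>/<a_i,x>], both [y - t0 x]
   and [t1 x - y] lie on proper faces, and they add up to [(t1 - t0) x]. *)
Lemma minkowski_rays r (rho : 'I_r -> V) x0 :
  (forall x, ccell x0 x -> face_rank arr (ccell x) = 1%N -> nonneg_comb rho x) ->
  forall x, ccell x0 x -> nonneg_comb rho x.
Proof.
(* Induction on the number of forms nonzero at [x], which drops on passing to a proper face. *)
move=> h1 x; have [m] := ubnP #|~: zset (sgv x)|.
elim: m x => // m IH x; rewrite ltnS => xm x0x.
have [xT|nxT] := pselect (fl top x).
  exists (fun=> 0) => // i; rewrite xT ?finset.in_setT // big1 // => k _.
  by rewrite mul0r.
have [r1|nr1] := eqVneq (face_rank arr (ccell x)) 1%N; first exact: h1.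
have [i0 [y [xi0 yi0 yx nyT]]] := face_rank_neq1 nr1 nxT.
have [i1 yi1] : exists i, dotv (a i) y != 0.
  apply: contrapT => h; apply: nyT => i _; apply/eqP.
  by apply: contrapT => /negP yi; apply: h; exists i.
have yz i : dotv (a i) x = 0 -> dotv (a i) y = 0.
  by move=> e; apply: yx; rewrite in_zset e.
pose lam i := dotv (a i) y / dotv (a i) x.
have lamE i : dotv (a i) x != 0 -> dotv (a i) y = lam i * dotv (a i) x.
  by move=> xi; rewrite divfK.
have xi1 : dotv (a i1) x != 0 by apply: contra yi1 => /eqP/yz ->.
pose P i := dotv (a i) x != 0.
have [j0 Pj0 minj] := @Order.TotalTheory.arg_minP _ _ _ i0 P lam xi0.
have [j1 Pj1 maxj] := @Order.TotalTheory.arg_maxP _ _ _ i0 P lam xi0.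
have {}minj i : P i -> lam j0 <= lam i by exact: minj.
have {}maxj i : P i -> lam i <= lam j1 by exact: maxj.
have lam1 : lam i1 != 0 by rewrite mulf_neq0 ?invr_neq0.
have lam0 : lam i0 = 0 by rewrite /lam yi0 mul0r.
have lt01 : lam j0 < lam j1.
  have := minj _ xi0; have := maxj _ xi0; have := minj _ xi1; have := maxj _ xi1.
  by rewrite lam0; case: (ltrgt0P (lam i1)) lam1 => // ? _ ? ? ? ?; lra.
have step z j : P j -> dotv (a j) z = 0 -> ccell x z -> nonneg_comb rho z.
  move=> Pj zj xz; apply: IH; last exact: ccell_trans x0x _ xz.
  apply: leq_trans xm; apply: proper_card; apply/fintype.properP; split.
    apply/fintype.subsetP => i; rewrite !finset.in_setC !in_zset; apply: contra => /eqP.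
    by move=> /(xz i).1 ->.
  by exists j; rewrite !finset.in_setC !in_zset // zj eqxx.
apply: (@nonneg_comb_add _ _ (y - lam j0 *: x) (lam j1 *: x - y) _ (lam j1 - lam j0)).
- by rewrite subr_gt0.
- by move=> i; rewrite !dotvBr !dotvZr; ring.
- apply: (step _ j0 Pj0); first by rewrite dotvBr dotvZr lamE // subrr.
  move=> i; rewrite dotvBr dotvZr; split=> [xi|].
    by rewrite yz // xi mulr0 subrr.
  have [->|xi] := eqVneq (dotv (a i) x) 0; first by rewrite mul0r.
  rewrite (lamE i xi) -mulrBl mulrCA mulr_ge0 ?subr_ge0 ?minj //; exact: sqr_ge0.
- apply: (step _ j1 Pj1); first by rewrite dotvBr dotvZr lamE // subrr.
  move=> i; rewrite dotvBr dotvZr; split=> [xi|].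
    by rewrite yz // xi mulr0 subrr.
  have [->|xi] := eqVneq (dotv (a i) x) 0; first by rewrite mul0r.
  rewrite (lamE i xi) -mulrBl mulrCA mulr_ge0 ?subr_ge0 //; [exact: maxj|exact: sqr_ge0].
Qed.

Lemma regular_perturb x y : regular x -> exists2 e : R, 0 < e &
  forall t, `|t| <= e -> sgv (x + t *: y) = sgv x.
Proof.
move=> rx; have [e e0 he] := sg3_perturb [seq a i | i <- enum 'I_n] x y.
exists e => // t te; apply/sgv_eqP => i; apply: he => //; last exact/eqP.
by apply: map_f; rewrite mem_enum.
Qed.

Lemma ccell_regular x y : ccell x y -> regular y -> sgv y = sgv x.
Proof.
move=> xy ry; apply/esym/ccell_anti => // i; split=> [/ry//|].
by rewrite mulrC; exact: (xy i).2.
Qed.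

(* [rho] are the rays of the region of [x0], modulo [bot], and [f k] is the wall
   opposite to [rho k]. *)
Definition dual_system x0 r (f : 'I_r -> 'I_n) (rho : 'I_r -> V) :=
  [/\ forall k, ccell x0 (rho k),
      forall j k, j != k -> dotv (a (f j)) (rho k) = 0,
      forall k, dotv (a (f k)) (rho k) != 0 &
      forall x i, dotv (a i) x =
        \sum_k dotv (a (f k)) x / dotv (a (f k)) (rho k) * dotv (a i) (rho k)].

(** Dimension count: [bot] has dimension [d - rkf top] and, together with the [rkf top] vectors
    [rho k], spans the whole space. Hence these are independent and their span meets [bot]
    trivially. *)
Lemma comb_rays_inj (rho : 'I_(rkf top) -> V) :
  (forall x, exists c : 'I_(rkf top) -> R, forall i,
     dotv (a i) x = \sum_k c k * dotv (a i) (rho k)) ->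
  forall c : 'I_(rkf top) -> R,
    (forall i, \sum_k c k * dotv (a i) (rho k) = 0) -> forall k, c k = 0.
Proof.
move=> span c c0; set r := rkf top in rho span c c0 *.
pose M : 'M[R]_(r, d) := \matrix_k rho k; pose W := flmx a top.
have combE (b : 'I_r -> R) : (\row_k b k) *m M = \sum_k b k *: rho k.
  by rewrite mulmx_sum_row; apply: eq_bigr => k _; rewrite mxE rowK.
have dot_comb b i : dotv (a i) ((\row_k b k) *m M) = \sum_k b k * dotv (a i) (rho k).
  by rewrite combE dotv_sumr; apply: eq_bigr => k _; rewrite dotvZr.
have full : \rank (W + M)%MS = d.
  apply/eqP; rewrite eqn_leq rank_leq_col -{1}(mxrank1 R d) mxrankS //.
  apply/row_subP => j; set x := row j _; have [b hb] := span x.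
  rewrite -[x](subrK ((\row_k b k) *m M)) addmx_sub_adds ?submxMl //.
  by apply/flmxP => i _; rewrite dotvBr dot_comb hb subrr.
have := mxrank_sum_cap W M; rewrite full rank_flmx -/r.
have rM := rank_leq_row M; have rd : (r <= d)%N := rkf_le a top.
move=> cap; have cap0 : \rank (W :&: M)%MS = 0%N by lia.
have freeM : row_free M by apply/eqP; lia.
have : ((\row_k c k) *m M <= W :&: M)%MS.
  rewrite sub_capmx submxMl andbT; apply/flmxP => i _; rewrite dot_comb; exact: c0.
move/eqP: cap0; rewrite mxrank_eq0 => /eqP ->; rewrite submx0 => /eqP.
rewrite -(mul0mx _ M) => /(row_free_inj freeM) /rowP e k.
by have := e k; rewrite !mxE.
Qed.

(** The rays generate the region as a cone, and hence the whole space modulo [bot] because the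
    region is open around [x0]. Simpliciality says that their number is the rank, so they form a
    basis modulo [bot]. *)
Lemma simplicial_dual_system x0 : simplicial arr -> regular x0 ->
  exists f rho, @dual_system x0 (rkf top) f rho.
Proof.
move=> simp rx0; have := simp (ccell x0); rewrite arr_rankE => /(_ _).
have /[swap]/[apply] : region arr (ccell x0) by apply/regionP; exists x0.
rewrite card_eq_sym => /card_set_bijP[g [gI _ gsurj]].
have rhoP (k : 'I_(rkf top)) : exists x, [/\ g k = ccell x, face_rank arr (ccell x) = 1%N & ccell x0 x].
  have [/faceP[x gx] [r1 sub]] := gI k (ltn_ord k).
  by exists x; split; rewrite -?gx //; apply: sub; rewrite gx; exact: ccell_refl.
have [rho rhoE] := choice rhoP; have {}rhoP k : ccell x0 (rho k) by case: (rhoE k).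
have comb x : ccell x0 x -> nonneg_comb rho x.
  apply: minkowski_rays x => x x0x r1.
  have [] := gsurj (ccell x).
    by split; [apply/faceP; exists x|split=> //; exact: ccell_trans].
  move=> k0 /= k0r gk0; pose k := Ordinal k0r; have [gk rk _] := rhoE k.
  have e : sgv x = sgv (rho k) by apply/ccell_eqP; rewrite -gk -gk0.
  have [c hc] : exists c, forall i, dotv (a i) x = c * dotv (a i) (rho k).
    by apply: face_rank1_ray => //; rewrite -e; exact: fl_zset_refl.
  exists (fun j => if j == k then c else 0); last first.
    by move=> i; rewrite (bigD1 k) //= eqxx big1 ?addr0 // => j /negbTE ->; rewrite mul0r.
  move=> j; case: eqP => // _.
  have [i ri] : exists i, dotv (a i) (rho k) != 0.
    apply: contrapT => h; move: rk; rewrite face_rank_ccell.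
    suff -> : zset (sgv (rho k)) = top by rewrite subnn.
    apply/setP => i; rewrite in_zset finset.in_setT; apply/eqP/eqP.
    by apply: contrapT => /negP ri; apply: h; exists i.
  have [_] := ccell_sgv e i; rewrite hc -mulrA pmulr_lge0 //.
  by rewrite lt_def mulf_neq0 //= sqr_ge0.
have span x : exists c : 'I_(rkf top) -> R, forall i, dotv (a i) x = \sum_k c k * dotv (a i) (rho k).
  have [e e0 he] := regular_perturb x rx0.
  have [|c1 _ h1] := comb (x0 + e *: x).
    by apply: ccell_sgv; rewrite he // gtr0_norm.
  have [|c2 _ h2] := comb x0; first exact: ccell_refl.
  exists (fun k => e^-1 * (c1 k - c2 k)) => i.
  apply: (mulfI (lt0r_neq0 e0)); have := h1 i; rewrite dotvDr dotvZr h2 => /esym/eqP.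
  rewrite addrC -subr_eq => /eqP <-; rewrite -sumrB mulr_sumr; apply: eq_bigr => k _.
  by rewrite !mulrA divff ?gt_eqF // mul1r mulrBl.
have inj := comb_rays_inj span.
(* The sum [s] of the rays other than [rho j] is not interior: otherwise [s - e *: rho j] would stay
   in the cone with coefficient [- e] at [j], contradicting uniqueness of coefficients. A hyperplane
   through [s] contains each of these rays, as its form has one sign on the cone. *)
have wall (j : 'I_(rkf top)) : exists i,
    (forall k, j != k -> dotv (a i) (rho k) = 0) /\ dotv (a i) (rho j) != 0.
  pose s := \sum_(k | j != k) rho k.
  have sx0 : ccell x0 s.
    rewrite /s; elim/big_ind: _ => //; first by move=> i; rewrite dotv0r mulr0.
    by move=> y z hy hz; rewrite -[y]scale1r -[z]scale1r; exact: ccell_add.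
  have [i si] : exists i, dotv (a i) s = 0.
    apply: contrapT => h; have rs : regular s by move=> i si; apply: h; exists i.
    have [e e0 he] := regular_perturb (rho j) rs.
    have [|c c0 hc] := comb (s + (- e) *: rho j).
      apply: ccell_sgv; rewrite he; first by apply/esym/ccell_regular.
      by rewrite normrN gtr0_norm.
    have := inj (fun k => c k - (if j != k then 1 else - e)).
    have ccj := c0 j; move=> /(_ _) /(_ j); rewrite eqxx /= => hj.
    suff : c j - - e = 0 by lra.
    apply: hj => i; under eq_bigr do rewrite mulrBl; rewrite sumrB -hc dotvDr dotvZr.
    rewrite (bigD1 j) //= eqxx /= dotv_sumr (eq_bigl (fun k => k != j)); last by move=> k; rewrite eq_sym.
    rewrite [X in _ - (_ + X)](eq_bigr (fun k => dotv (a i) (rho k))); last first.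
      by move=> k; rewrite eq_sym => ->; rewrite mul1r.
    by ring.
  exists i; have rk0 k : j != k -> dotv (a i) (rho k) = 0.
    have /eqP := si; rewrite dotv_sumr -(mulrI_eq0 _ (mulfI _ (x := dotv (a i) x0))); last exact/eqP/rx0.
    rewrite mulr_sumr psumr_eq0 => [/allP h jk|l _]; last exact: (rhoP l i).2.
    have := h k (mem_index_enum _); rewrite jk mulf_eq0 => /orP[/eqP/rx0//|/eqP//].
  split=> //; apply/eqP => rj; apply: (rx0 i).
  have [c ->] := span x0; rewrite big1 // => k _; have [<-|jk] := eqVneq j k.
    by rewrite rj mulr0.
  by rewrite rk0 // mulr0.
have [f fP] := choice wall.
exists f, rho; split=> //.
- by move=> j k jk; apply: (fP j).1.
- by move=> k; apply: (fP k).2.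
move=> x i; have [c hc] := span x; rewrite hc; apply: eq_bigr => k _; congr (_ * _).
rewrite hc (bigD1 k) //= big1 ?addr0 ?mulfK //; first exact: (fP k).2.
by move=> j jk; rewrite (fP k).1 ?mulr0 // eq_sym.
Qed.
End SimplicialCones.

(** The binomial theorem, grouped by cardinality. At [y = 'X - 1] it turns the faces sent to one
    region into a single power of ['X]. *)
Lemma sum_subset_expr (T : finType) (A : comNzRingType) (D : {set T}) (y : A) :
  \sum_(S : {set T} | S \subset D) y ^+ #|S| = (1 + y) ^+ #|D|.
Proof.
rewrite exprDn (partition_big (fun S : {set T} => inord #|S| : 'I_#|D|.+1) xpredT) //=.
apply: eq_bigr => k _; rewrite expr1n mul1r -cards_draws -sumr_const.
have cardE (S : {set T}) : S \subset D -> (inord #|S| == k) = (#|S| == k :> nat).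
  by move=> SD; rewrite -val_eqE /= inordK // ltnS subset_leq_card.
apply: eq_big => [S|S /andP[SD]]; last by rewrite cardE // => /eqP ->.
by rewrite inE; case: (boolP (S \subset D)) => //= /cardE.
Qed.

(** * Faces, adjacent regions and descents of a simplicial region *)

Section DualSystem.
Variables (R : realType) (d n : nat) (a : 'I_n -> 'rV[R]_d).
Notation V := 'rV[R]_d.
Notation sgv := (sgv a).
Notation arr := (arr a).
Notation fl := (fl a).
Notation rkf := (rkf a).
Notation ccell := (ccell a).
Notation regular := (regular a).
Implicit Types (x y z : V).

Definition pside x i := 0 < dotv (a i) x.

Lemma sgv_regularP x y : regular x -> regular y ->
  (forall i, pside x i = pside y i) <-> sgv x = sgv y.
Proof.
move=> rx ry; rewrite sgv_eqP; split=> h i; have := h i; rewrite /pside /sg3;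
  have /eqP/negbTE -> := rx i; have /eqP/negbTE -> := ry i.
  by move=> ->.
by case.
Qed.

Lemma pside_neq x y i : regular x -> regular y ->
  (pside x i != pside y i) = (dotv (a i) x * dotv (a i) y < 0).
Proof.
move=> rx ry; have /eqP := rx i; have /eqP := ry i; rewrite /pside.
case: (ltrgt0P (dotv (a i) x)) => // hx; case: (ltrgt0P (dotv (a i) y)) => // hy _ _ /=;
  apply/esym; first [by apply/negbTE; rewrite -leNgt; nra | by nra].
Qed.

Lemma separates_hyp v x i : regular v -> regular x ->
  separates (hyp a i) (ccell v) (ccell x) <-> pside v i != pside x i.
Proof.
move=> rv rx; rewrite pside_neq //; split=> [[b [bi [bv bx]]]|lt0].
  have iff y : dotv (a i) y = 0 <-> dotv b y = 0.
    by have /seteqP[h1 h2] := bi; split=> [/h1|/h2].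
  have bv0 : dotv b v < 0.
    rewrite lt_neqAle bv ?andbT; last exact: ccell_refl.
    by apply/eqP => /iff; exact: rv.
  have bx0 : 0 < dotv b x.
    rewrite lt_neqAle bx ?andbT; last exact: ccell_refl.
    by apply/eqP => /esym /iff; exact: rx.
  (* Both coefficients are positive, so this is, up to scaling, where the segment from [v] to [x]
     crosses the hyperplane. *)
  have /iff : dotv b (dotv b x *: v - dotv b v *: x) = 0.
    by rewrite dotvBr !dotvZr mulrC subrr.
  rewrite dotvBr !dotvZr => e; rewrite ltNge; apply/negP => ge0.
  have /eqP := rv i; move: e ge0 bv0 bx0; clear.
  set p := dotv (a i) v; set q := dotv (a i) x; set u := dotv b x; set w := dotv b v.
  case: (ltrgt0P p) => // p0 e; [rewrite pmulr_rge0 // => q0|rewrite nmulr_rge0 // => q0] => w0 u0 _.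
    have : 0 < u * p by rewrite mulr_gt0.
    have : w * q <= 0 by rewrite nmulr_rle0.
    by lra.
  have : u * p < 0 by rewrite pmulr_rlt0.
  have : 0 <= w * q by rewrite nmulr_rge0.
  by lra.
(* Orients the normal so that [v] is on its negative side, as [separates] requires. *)
pose c := if 0 < dotv (a i) v then -1 else 1 : R.
have c0 : c != 0 by rewrite /c; case: ifP; rewrite ?oppr_eq0 oner_eq0.
have cv : c * dotv (a i) v < 0.
  rewrite /c; case: (ltP 0 (dotv (a i) v)) => h; first by lra.
  by rewrite mul1r lt_neqAle h andbT; apply/eqP/rv.
have cx : 0 < c * dotv (a i) x by rewrite /c in cv *; case: (ltP 0 (dotv (a i) v)) cv => h cv; nra.
exists (c *: a i); split; last split.
- apply/seteqP; split=> y; rewrite /hyp /= dotvZl; first by move=> ->; rewrite mulr0.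
  by move=> /eqP; rewrite mulf_eq0 (negbTE c0) => /eqP.
- move=> y /(_ i)[_]; rewrite dotvZl => h; move: c0 cv; case: (ltrgt0P c) => // c0 _ cv; nra.
- move=> y /(_ i)[_]; rewrite dotvZl => h; move: c0 cx; case: (ltrgt0P c) => // c0 _ cx; nra.
Qed.

Lemma weak_leP v x y : regular v -> regular x -> regular y ->
  weak_le arr (ccell v) (ccell x) (ccell y) <->
  forall i, pside v i != pside x i -> pside v i != pside y i.
Proof.
move=> rv rx ry; split=> h.
  by move=> i /separates_hyp => /(_ rv rx) /h; rewrite separates_hyp //; apply; exists i.
by move=> _ [i _ <-]; rewrite !separates_hyp //; exact: h.
Qed.

Hypothesis hyp_inj : injective (hyp a).
Variables (x0 : V) (r : nat) (f : 'I_r -> 'I_n) (rho : 'I_r -> V).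
Hypotheses (rx0 : regular x0) (dual : dual_system a x0 f rho).
Implicit Types S : {set 'I_r}.

(** The wall normals rescaled to be dual to the rays; this also makes them point into the region. *)
Definition nu k : V := (dotv (a (f k)) (rho k))^-1 *: a (f k).

Lemma rho_ccell k : ccell x0 (rho k).
Proof. by case: dual. Qed.

Lemma nu_rho j k : dotv (nu j) (rho k) = (j == k)%:R.
Proof.
case: dual => _ h1 h2 _; rewrite dotvZl; have [<-|jk] := eqVneq j k.
  by rewrite mulVf.
by rewrite (h1 j k jk) mulr0.
Qed.

Lemma dotv_nu i x : dotv (a i) x = \sum_k dotv (nu k) x * dotv (a i) (rho k).
Proof.
case: dual => _ _ _ h; rewrite {1}h; apply: eq_bigr => k _.
by rewrite dotvZl [in RHS]mulrC [_^-1 * _]mulrC mulrC.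
Qed.

Lemma nu_eq0 k x : (dotv (nu k) x == 0) = (dotv (a (f k)) x == 0).
Proof. by case: dual => _ _ h _; rewrite dotvZl mulf_eq0 invr_eq0 (negbTE (h k)). Qed.

Lemma nu_mul k x : dotv (a (f k)) x = dotv (a (f k)) (rho k) * dotv (nu k) x.
Proof. by case: dual => _ _ h _; rewrite dotvZl mulrA divff ?mul1r. Qed.

Lemma wall_rho_gt0 k : 0 < dotv (a (f k)) x0 * dotv (a (f k)) (rho k).
Proof.
case: dual => _ _ h _; rewrite lt_def mulf_neq0 ?h //=; first exact: (rho_ccell k (f k)).2.
exact/eqP/rx0.
Qed.

Lemma nu_ge0 k z : ccell x0 z -> 0 <= dotv (nu k) z.
Proof.
move=> /(_ (f k))[_]; rewrite (nu_mul k z) mulrA pmulr_rge0 //; exact: wall_rho_gt0.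
Qed.

Lemma pside_wall k x : regular x -> (pside x (f k) != pside x0 (f k)) = (dotv (nu k) x < 0).
Proof.
move=> rx; rewrite pside_neq // mulrC (nu_mul k x) mulrA pmulr_rlt0 //; exact: wall_rho_gt0.
Qed.

(** The form [a i] has one sign on all rays, so it can vanish at [z] only if it vanishes on each ray
    that has a nonzero coefficient in [z]. *)
Lemma ccell_zeroP z i : ccell x0 z ->
  dotv (a i) z = 0 <-> forall k, dotv (nu k) z != 0 -> dotv (a i) (rho k) = 0.
Proof.
move=> x0z; split=> [zi k nz|h]; last first.
  rewrite dotv_nu big1 // => k _; have [->|/h ->] := eqVneq (dotv (nu k) z) 0.
    by rewrite mul0r.
  by rewrite mulr0.
have : \sum_k dotv (nu k) z * (dotv (a i) x0 * dotv (a i) (rho k)) = 0.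
  under eq_bigr do rewrite mulrCA; rewrite -mulr_sumr -dotv_nu zi mulr0 //.
move/eqP; rewrite psumr_eq0 => [/allP/(_ k (mem_index_enum _))|l _]; last first.
  by rewrite mulr_ge0 ?nu_ge0 //; exact: (rho_ccell l i).2.
by rewrite !mulf_eq0 (negbTE nz) /= => /orP[/eqP/rx0//|/eqP].
Qed.

Lemma sgv_eq_zeros y z : ccell x0 y -> ccell x0 z ->
  (forall i, dotv (a i) y = 0 <-> dotv (a i) z = 0) -> sgv y = sgv z.
Proof.
move=> x0y x0z h; have sgn i : 0 <= dotv (a i) y * dotv (a i) z.
  have /eqP := @rx0 i; have := (x0y i).2; have := (x0z i).2.
  case: (ltrgt0P (dotv (a i) x0)) => // h0.
    by rewrite !(pmulr_rge0 _ h0) => h1 h2 _; exact: mulr_ge0.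
  by rewrite !(nmulr_rge0 _ h0) => h1 h2 _; exact: mulr_le0.
by apply: ccell_anti => i; split; rewrite ?sgn //; [move/h|move/h|rewrite mulrC].
Qed.

(* A relative interior point of the intersection of the walls in [S]. *)
Definition facept S : V := \sum_(k | k \notin S) rho k.

Lemma facept_ccell S : ccell x0 (facept S).
Proof.
rewrite /facept; elim/big_ind: _ => [i|y z hy hz|k _]; last exact: rho_ccell.
  by rewrite dotv0r mulr0.
by rewrite -[y]scale1r -[z]scale1r; exact: ccell_add.
Qed.

Lemma nu_facept k S : dotv (nu k) (facept S) = (k \notin S)%:R.
Proof.
rewrite dotv_sumr; under eq_bigr do rewrite nu_rho.
have [kS|kS] := boolP (k \in S).
  by rewrite big1 // => j jS; case: eqP => // e; rewrite -e kS in jS.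
rewrite (bigD1 k) //= eqxx big1 ?addr0 // => j /andP[_].
by rewrite eq_sym => /negbTE ->.
Qed.

Lemma facept_zeroP S i :
  dotv (a i) (facept S) = 0 <-> forall k, k \notin S -> dotv (a i) (rho k) = 0.
Proof.
rewrite (ccell_zeroP i (facept_ccell S)); split=> h k kS; apply: h.
  by rewrite nu_facept kS oner_neq0.
by move: kS; rewrite nu_facept; case: (k \notin S); rewrite ?eqxx.
Qed.

(** Every face of the region is thus determined by the set of walls containing it. *)
Lemma sgv_facept z : ccell x0 z ->
  sgv (facept (finset (fun k => dotv (nu k) z == 0))) = sgv z.
Proof.
move=> x0z; apply: sgv_eq_zeros => //; first exact: facept_ccell.
move=> i; rewrite facept_zeroP ccell_zeroP //.
by split=> h k hk; apply: h; rewrite inE in hk *.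
Qed.

Lemma dotv_facept_zero S i x : dotv (a i) (facept S) = 0 ->
  dotv (a i) x = \sum_(k in S) dotv (nu k) x * dotv (a i) (rho k).
Proof.
move=> /facept_zeroP h; rewrite dotv_nu (bigID (fun k => k \in S)) /=.
by rewrite [X in _ + X]big1 ?addr0 // => k /h ->; rewrite mulr0.
Qed.

Lemma rank_nu (l : seq 'I_r) : uniq l ->
  \rank (znormals [seq (nu k, @None bool) | k <- l]) = size l.
Proof.
elim: l => [|k l IH] /=; first by rewrite /znormals big_nil mxrank0.
move=> /andP[kl ul]; rewrite znormals_cons /= rank_adds_row ?IH //.
apply/negP => /sub_znormalsP /(_ (rho k)); rewrite nu_rho eqxx => h.
have /h/eqP : cell_flat [seq (nu k0, @None bool) | k0 <- l] (rho k).
  move=> p /mapP[j jl ->] _ /=; rewrite nu_rho.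
  by case: eqP => // e; rewrite -e jl in kl.
by rewrite oner_eq0.
Qed.

(** All hyperplanes through the face are combinations of the walls in [S], and these are
    independent. *)
Lemma rkf_facept S : rkf (zset (sgv (facept S))) = #|S|.
Proof.
rewrite cardE -(rank_nu (enum_uniq S)); apply: eq_rank_znormals => x.
rewrite cell_flat_zcstr; split=> [h p /mapP[k +  ->] _ /=|h i].
  rewrite mem_enum => kS; apply/eqP; rewrite nu_eq0; apply/eqP/h.
  by rewrite in_zset -nu_eq0 nu_facept kS.
rewrite in_zset => /eqP /dotv_facept_zero ->; rewrite big1 // => k kS.
have -> : dotv (nu k) x = 0; last by rewrite mul0r.
by apply: (h (nu k, None)) => //; apply: map_f; rewrite mem_enum.
Qed.

Lemma wall_unique i k : (forall l, l != k -> dotv (a i) (rho l) = 0) -> i = f k.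
Proof.
move=> h; have aE x : dotv (a i) x = dotv (nu k) x * dotv (a i) (rho k).
  by rewrite dotv_nu (bigD1 k) //= big1 ?addr0 // => l /h ->; rewrite mulr0.
have nz : dotv (a i) (rho k) != 0.
  by apply/eqP => e; apply: (rx0 (i := i)); rewrite aE e mulr0.
apply: hyp_inj; apply/seteqP; split=> x; rewrite /hyp /= => /eqP.
  by rewrite aE mulf_eq0 (negbTE nz) orbF nu_eq0 => /eqP.
by rewrite -nu_eq0 => /eqP e; rewrite aE e mul0r.
Qed.

Lemma facept1_zero i k : dotv (a i) (facept [set k]%SET) = 0 <-> i = f k.
Proof.
split=> [/facept_zeroP h|->]; last by apply/eqP; rewrite -nu_eq0 nu_facept inE eqxx.
by apply: wall_unique => l lk; apply: h; rewrite inE.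
Qed.

(** The adjacent region across the wall: from the interior of the facet, where only [f k] vanishes,
    take a small step against [rho k]. *)
Lemma flip_wall k : exists2 y, regular y &
  forall i, pside y i = (i == f k) (+) pside x0 i.
Proof.
have [e e0 he] := sg3_perturb [seq a i | i <- enum 'I_n] (facept [set k]%SET) (rho k).
have {}he i : i != f k -> sg3 (dotv (a i) (facept [set k]%SET + - e *: rho k)) = sg3 (dotv (a i) x0).
  move=> ik; rewrite he; first 1 last.
  - by rewrite normrN gtr0_norm.
  - by apply: map_f; rewrite mem_enum.
  - by apply: contra ik => /eqP/facept1_zero ->.
  have /eqP := @rx0 i; have := (facept_ccell [set k]%SET i).2.
  have : dotv (a i) (facept [set k]%SET) != 0.
    by apply: contra ik => /eqP/facept1_zero ->.
  case: (sg3P (dotv (a i) x0)) => [h|h|->]; rewrite ?eqxx // => n0 h2 _.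
    by apply/sg3_posP; rewrite lt_def n0 /=; nra.
  by apply/sg3_negP; rewrite lt_def eq_sym n0 /=; nra.
set y := facept _ + _ in he.
have yk : dotv (a (f k)) y = - e * dotv (a (f k)) (rho k).
  by rewrite dotvDr dotvZr (iffRL (facept1_zero (f k) k)) // add0r.
have wk := wall_rho_gt0 k.
exists y => i; have [->|ik] := eqVneq i (f k).
- move=> /eqP; rewrite yk mulf_eq0 oppr_eq0 (gt_eqF e0) /= => /eqP e1.
  by rewrite e1 mulr0 ltxx in wk.
- by move=> /sg3_0P; rewrite he // => /sg3_0P; exact: rx0.
- rewrite /pside yk /=; case: (ltrP 0 (dotv (a (f k)) x0)) => h /=.
    apply/negbTE; rewrite -leNgt mulNr oppr_le0 mulr_ge0 ?(ltW e0) // ltW //.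
    by rewrite -(pmulr_rgt0 _ h).
  have p0 : dotv (a (f k)) x0 < 0 by rewrite lt_neqAle h andbT; apply/eqP/rx0.
  by rewrite nmulr_rgt0 ?oppr_lt0 // -(nmulr_rgt0 _ p0).
- rewrite /= /pside; apply/idP/idP => /sg3_posP; rewrite ?he // => h.
    exact/sg3_posP.
  by apply/sg3_posP; rewrite he.
Qed.

(** The regions covered by that of [x0] are those across the walls separating it from [v]: any
    region strictly below it is beyond such a wall, and the region across that wall lies between the
    two. *)
Lemma des_nu v : regular v ->
  des arr (ccell v) (ccell x0) = #|[set k | dotv (nu k) v < 0]%SET|.
Proof.
move=> rv; have [y ry yE] : exists2 y : 'I_r -> V, forall k, regular (y k) &
    forall k i, pside (y k) i = (i == f k) (+) pside x0 i.
  have [y hy] := choice (fun k => (let: ex_intro2 e e1 e2 := flip_wall k in ex_intro _ e (conj e1 e2))).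
  by exists y => k; case: (hy k).
have f_inj : injective f.
  move=> j k e; apply/eqP/negPn/negP => /negbTE jk; have := nu_facept j [set j]%SET.
  have := nu_facept k [set j]%SET; rewrite !inE eqxx eq_sym jk /=.
  move=> h1 /eqP; rewrite nu_eq0 e -nu_eq0 h1; by rewrite oner_eq0.
have vy k : dotv (nu k) v < 0 -> pside v (f k) = pside (y k) (f k).
  by rewrite -pside_wall // yE eqxx; case: (pside v _); case: (pside x0 _).
rewrite /des (@fsbig_finType _ _ _ _ _ (fun k => ccell (y k)) (fun k => dotv (nu k) v < 0)).
- by rewrite sum1dep_card -cardsE; congr #|_|; apply/setP => k; rewrite !inE.
- move=> j k _ _ /ccell_eqP /(sgv_regularP (ry j) (ry k)) /(_ (f j)); rewrite !yE eqxx.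
  by case: eqP => [/f_inj//|_] /=; case: (pside _ _).
move=> D; split=> [[/regionP[z rz ->] le ne nE]|[k kv <-]].
  have lezx : forall i, pside v i != pside z i -> pside v i != pside x0 i by apply/weak_leP.
  (* If [z] were on the inner side of every wall, its region would be that of [x0]. *)
  have [k zk] : exists k, dotv (nu k) z < 0.
    apply: contrapT => h; apply: ne; apply/ccell_eqP; apply: ccell_regular rz => i.
    split=> [/rx0//|]; rewrite (dotv_nu i z) mulr_sumr sumr_ge0 // => k _.
    rewrite mulrCA mulr_ge0 //; last exact: (rho_ccell k i).2.
    by rewrite leNgt; apply/negP => zk; apply: h; exists k.
  have zk' : pside z (f k) != pside x0 (f k) by rewrite pside_wall.
  have vz : pside v (f k) = pside z (f k).
    apply/eqP; apply: contraT => h; have := lezx _ h; move: zk' h.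
    by case: (pside v _); case: (pside z _); case: (pside x0 _).
  have kv : dotv (nu k) v < 0 by rewrite -pside_wall // vz.
  exists k => //; apply: contrapT => nyz; apply: nE; exists (ccell (y k)); split=> //.
  - by apply/regionP; exists (y k).
  - apply/weak_leP => // i; rewrite yE; case: (eqVneq i (f k)) => [->|_] /=; last exact: lezx.
    by rewrite vz eqxx.
  - apply/weak_leP => // i; rewrite yE; case: (eqVneq i (f k)) => [->|_] //=.
    by rewrite vz eq_sym; case: (pside z _) zk'; case: (pside x0 _).
  - move=> /ccell_eqP /(sgv_regularP (ry k) rx0) /(_ (f k)); rewrite yE eqxx /=.
    by case: (pside _ _).
have vk : pside v (f k) != pside x0 (f k) by rewrite pside_wall.
split.
- by apply/regionP; exists (y k).
- apply/weak_leP => // i; rewrite yE; case: (eqVneq i (f k)) => [->|_] //=.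
- move=> /ccell_eqP /(sgv_regularP (ry k) rx0) /(_ (f k)); rewrite yE eqxx /=.
  by case: (pside _ _).
move=> [E [/regionP[z rz ->] /weak_leP yz /weak_leP zx ney nex]].
have {}yz := yz rv (ry k) rz; have {}zx := zx rv rz rx0.
(* Only [f k] separates the two ends of the interval, so a region in it can differ from [x0] at
   [f k] alone. *)
have zE i : i != f k -> pside z i = pside x0 i.
  move=> ik; have := yz i; have := zx i; rewrite yE (negbTE ik) /=.
  by case: (pside v _); case: (pside z _); case: (pside x0 _) => //= h1 h2;
    first [have := h1 isT | have := h2 isT].
have [zk|zk] := eqVneq (pside z (f k)) (pside x0 (f k)).
  apply: nex; apply/ccell_eqP/(sgv_regularP rz rx0) => i.
  by have [->|/zE] := eqVneq i (f k).
apply: ney; apply/ccell_eqP/(sgv_regularP rz (ry k)) => i; rewrite yE.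
have [->|/zE] := eqVneq i (f k) => //.
by move: zk; case: (pside z _); case: (pside x0 _).
Qed.
End DualSystem.

(** * Sharpness and the fibres of the map from faces to regions *)

Section SharpCones.
Variables (R : realType) (d n : nat) (a : 'I_n -> 'rV[R]_d).
Notation V := 'rV[R]_d.
Notation sgv := (sgv a).
Notation arr := (arr a).
Notation fl := (fl a).
Notation rkf := (rkf a).
Notation ccell := (ccell a).
Notation regular := (regular a).
Notation top := ([set: 'I_n]%SET).
Hypothesis hyp_inj : injective (hyp a).
Variables (x0 : V) (r : nat) (f : 'I_r -> 'I_n) (rho : 'I_r -> V).
Hypotheses (rx0 : regular x0) (dual : dual_system a x0 f rho).
Hypothesis sharp_arr : sharp arr.
Variable v : V.
Hypotheses (rv : regular v) (gen_v : generic_hyperplane arr (orth v)).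
Notation nu := (nu a f rho).
Notation facept := (facept rho).
Notation inneg := (inneg a v).
Implicit Types (x y z : V) (S : {set 'I_r}).

(** The expansion of [x] in rays holds modulo [bot], to which [v] is orthogonal by genericity. So
    the numbers [dotv v (rho k)] are the coordinates of [v] in the [nu k]. *)
Lemma dotv_generic x : dotv v x = \sum_k dotv (nu k) x * dotv v (rho k).
Proof.
have /(bot_orth gen_v) : fl top (x - \sum_k dotv (nu k) x *: rho k).
  move=> i _; rewrite dotvBr dotv_sumr [X in X - _](dotv_nu dual).
  by apply/eqP; rewrite subr_eq0; apply/eqP/eq_bigr => k _; rewrite dotvZr.
rewrite dotvBr dotv_sumr => /eqP; rewrite subr_eq0 => /eqP ->.
by apply: eq_bigr => k _; rewrite dotvZr.
Qed.

Lemma facet_wall k : ccell x0 `&` hyp a (f k) = ccell (facept [set k]%SET).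
Proof.
have x0k := facept_ccell dual [set k]%SET.
apply/seteqP; split=> [y [x0y yk]|y ky].
  move=> i; split=> [/(facept1_zero hyp_inj rx0 dual) ->//|].
  have /eqP := @rx0 i; have := (x0y i).2; have := (x0k i).2.
  case: (ltrgt0P (dotv (a i) x0)) => // h0.
    by rewrite !(pmulr_rge0 _ h0) => h1 h2 _; exact: mulr_ge0.
  by rewrite !(nmulr_rge0 _ h0) => h1 h2 _; exact: mulr_le0.
split; first exact: ccell_trans x0k _ ky.
by apply: (ky (f k)).1; apply/(facept1_zero hyp_inj rx0 dual).
Qed.

Lemma sharp_gram j k : j != k -> dotv (nu j) (nu k) <= 0.
Proof.
move=> jk; case: sharp_arr => _ sh.
have facetP l : facet arr (ccell x0) (ccell x0 `&` hyp a (f l)).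
  exists (hyp a (f l)); split; first by exists (f l).
  by split=> //; rewrite facet_wall dims_ccell (rkf_facept rx0 dual) cards1.
have normalP l : inward_normal arr (ccell x0) (ccell x0 `&` hyp a (f l)) (nu l).
  split.
  - apply/eqP => e; have := nu_rho dual l l; rewrite eqxx e.
    by rewrite dotvC dotv0r => /esym/eqP; rewrite oner_eq0.
  - move=> y; rewrite -fl_setT => /(_ (f l)); rewrite finset.in_setT => /(_ isT) e.
    by apply/eqP; rewrite (nu_eq0 dual) e.
  - by move=> y [_ e]; apply/eqP; rewrite (nu_eq0 dual); apply/eqP.
  - by move=> y; exact: (nu_ge0 rx0 dual).
apply: (sh (ccell x0) _ _ _ _ _ (facetP j) (facetP k) _ (normalP j) (normalP k)).
  by apply/regionP; exists x0.
(* The two facets differ: [rho j] lies on the wall [f k] but not on its opposite wall [f j]. *)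
move=> /seteqP[_ /(_ (rho j))] h; have /h[_] : (ccell x0 `&` hyp a (f k)) (rho j).
  split; first exact: rho_ccell dual _.
  by apply/eqP; rewrite -(nu_eq0 dual) (nu_rho dual) (eq_sym k) (negbTE jk).
by move=> /eqP; rewrite -(nu_eq0 dual) (nu_rho dual) eqxx oner_eq0.
Qed.

(* The Gram matrix of the [nu k] is an M-matrix. With [w] the combination of the
   [nu k] whose coefficients are the positive parts of the coordinates
   [<v, rho k>] of [v], one gets [|w|^2 <= <v, w> <= 0]. *)
Lemma sharp_rays S : (forall k, k \notin S -> dotv v (rho k) <= 0) ->
  (forall k, k \in S -> dotv (nu k) v < 0) -> forall k, dotv v (rho k) <= 0.
Proof.
move=> hn hS; pose p k := Num.max (dotv v (rho k)) 0.
have p0 k : 0 <= p k by rewrite le_max lexx orbT.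
pose w := \sum_k p k *: nu k.
have dw x : dotv x w = \sum_k p k * dotv x (nu k).
  by rewrite dotv_sumr; apply: eq_bigr => k _; rewrite dotvZr.
have vw : dotv v w <= 0.
  rewrite dw sumr_le0 // => k _; rewrite dotvC.
  have [/hS h|/hn h] := boolP (k \in S); first by rewrite mulr_ge0_le0 // ltW.
  by rewrite /p (max_idPr h) mul0r.
(* Termwise: for [k != l] the factor [p k * dotv (nu l) (nu k)] is nonpositive and [p l] is at least
   [dotv v (rho l)]. For [k = l] both terms vanish unless [p l] equals that coordinate. *)
have ww : dotv w w <= dotv v w.
  rewrite [leLHS]dw (dotv_generic w); apply: ler_sum => l _.
  rewrite mulrC (dotvC w) dw !mulr_suml; apply: ler_sum => k _.
  have pl : dotv v (rho l) <= p l by rewrite le_max lexx.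
  have [->|kl] := eqVneq k l.
    rewrite /p; case: (lerP (dotv v (rho l)) 0) => h; last by rewrite lexx.
    by rewrite !mul0r.
  rewrite ler_wnM2l // mulr_ge0_le0 // sharp_gram // eq_sym //.
have /dotvv_eq0 w0 : dotv w w = 0.
  by apply/eqP; rewrite eq_le dotvv_ge0 andbT (le_trans ww).
move=> k; have : dotv (rho k) w = p k.
  rewrite dw (bigD1 k) //= dotvC (nu_rho dual) eqxx mulr1 big1 ?addr0 // => j jk.
  by rewrite dotvC (nu_rho dual) (negbTE jk) mulr0.
by rewrite w0 dotv0r => e; rewrite e le_max lexx.
Qed.

Lemma inneg_ccell x : inneg (sgv x) -> forall y, ccell x y -> dotv v y <= 0.
Proof.
move=> /asboolP xv y xy; rewrite leNgt; apply/negP => vy.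
have [e e0 he] := sg3_perturb [:: v] y x.
have := xv _ (ccell_perturb xy e0); rewrite leNgt => /negP; apply.
apply/sg3_posP; rewrite he ?inE ?gt_eqF // ?gtr0_norm //; exact/sg3_posP.
Qed.

(* The composition of covectors [s o (- v)]. *)
Definition upper (s : {ffun 'I_n -> option bool}) : {ffun 'I_n -> option bool} :=
  [ffun i => if s i is Some b then Some b else Some (~~ pside a v i)].

Lemma upper_ccell z : upper (sgv z) = sgv x0 -> ccell x0 z.
Proof.
move=> /ffunP up i; split=> [/rx0//|]; have := up i; rewrite !ffunE.
case: (sg3P (dotv (a i) z)) => [zi /esym/sg3_posP|zi /esym/sg3_negP|-> _].
- by move=> h; rewrite mulr_ge0 // ltW.
- by move=> h; rewrite mulr_le0 // ltW.
- by rewrite mulr0.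
Qed.

(** On a wall in [S] the composition picks the side opposite to [v], so every such wall must
    separate [v] from [x0]. If they all do, so does any hyperplane through the face, by the
    expansion [dotv_facept_zero]. *)
Lemma upper_facept S :
  (upper (sgv (facept S)) == sgv x0) = (S \subset [set k | dotv (nu k) v < 0]%SET).
Proof.
apply/eqP/fintype.subsetP => [/ffunP up k kS|h].
  rewrite inE -(pside_wall rx0 dual) //; have := up (f k); rewrite !ffunE.
  have /eqP fk : dotv (a (f k)) (facept S) == 0.
    by rewrite -(nu_eq0 dual) (nu_facept dual) kS.
  rewrite fk {1}/sg3 eqxx /sg3; have /eqP/negbTE -> := @rx0 (f k).
  by rewrite -/(pside a x0 (f k)) => -[<-]; case: (pside _ _ _).
apply/ffunP => i; rewrite !ffunE.
case: (sg3P (dotv (a i) (facept S))) => [pi|pi|zi].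
- apply/esym/sg3_posP; have /eqP := @rx0 i; have := (facept_ccell dual S i).2.
  by rewrite pmulr_lge0 // lt_def => -> /= ->.
- apply/esym/sg3_negP; have /eqP := @rx0 i; have := (facept_ccell dual S i).2.
  by rewrite nmulr_lge0 // lt_neqAle => -> /= ->.
rewrite /sg3; have /eqP/negbTE -> := @rx0 i; congr Some.
rewrite -/(pside a x0 i); have : pside a v i != pside a x0 i.
  rewrite pside_neq // lt_neqAle mulf_neq0 /=; [|exact/eqP/rv|exact/eqP/rx0].
  rewrite (dotv_facept_zero rx0 dual v zi) mulr_suml sumr_le0 // => k kS.
  rewrite -mulrA mulr_le0_ge0 //; first by have := h k kS; rewrite inE => /ltW.
  by rewrite mulrC; exact: (rho_ccell dual k i).2.
by case: (pside a v i); case: (pside a x0 i).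
Qed.

(** From region to face, the half-space condition passes to the closure. From face to region, the
    rays of the face and the descent walls through it are the two hypotheses of [sharp_rays]. *)
Lemma inneg_upper z : upper (sgv z) = sgv x0 -> inneg (sgv z) = inneg (sgv x0).
Proof.
move=> up; have x0z := upper_ccell up.
apply/idP/idP => [zv|x0v]; last first.
  apply/asboolP => y zy; apply: (inneg_ccell x0v).
  by apply: (ccell_trans x0z); apply: ccell_sgv; rewrite zy.
pose S := finset (fun k => dotv (nu k) z == 0).
have ray k : dotv v (rho k) <= 0.
  apply: (@sharp_rays S) k => k.
    rewrite inE => nz; apply: (inneg_ccell zv) => i; split.
      by move=> /(ccell_zeroP rx0 dual i x0z); apply.
    have /eqP := @rx0 i; have := (x0z i).2; have := (rho_ccell dual k i).2.
    case: (ltrgt0P (dotv (a i) x0)) => // h0.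
      by rewrite !(pmulr_rge0 _ h0) => h1 h2 _; exact: mulr_ge0.
    by rewrite !(nmulr_rge0 _ h0) => h1 h2 _; exact: mulr_le0.
  move=> kS; have : S \subset [set k | dotv (nu k) v < 0]%SET.
    by rewrite -upper_facept (sgv_facept rx0 dual x0z) up.
  by move=> /fintype.subsetP/(_ _ kS); rewrite inE.
apply/asboolP => y /esym /ccell_sgv x0y; rewrite dotv_generic sumr_le0 // => k _.
by rewrite mulr_ge0_le0 //; exact: (nu_ge0 rx0 dual).
Qed.

Lemma sum_upper :
  \sum_(s | iscov a s && (upper s == sgv x0)) ('X - 1) ^+ rkf (zset s) =
  'X^(des arr (ccell v) (ccell x0)) :> {poly int}.
Proof.
rewrite (reindex_onto (fun S => sgv (facept S))
  (fun s => finset (fun k : 'I_r => s (f k) == None))) /=; last first.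
  move=> s /andP[/asboolP[z <-] /eqP up]; rewrite -[RHS](sgv_facept rx0 dual (upper_ccell up)).
  congr (sgv (facept _)); apply/setP => k; rewrite !inE ffunE (nu_eq0 dual).
  by rewrite /sg3; case: (_ == 0).
rewrite (eq_bigl (fun S => S \subset [set k | dotv (nu k) v < 0]%SET)); last first.
  move=> S; rewrite upper_facept; have -> : iscov a (sgv (facept S)).
    by apply/asboolP; exists (facept S).
  rewrite /= andb_idr // => _; apply/eqP/setP => k; rewrite inE ffunE.
  rewrite /sg3 -(nu_eq0 dual) (nu_facept dual).
  by case: (k \in S); rewrite ?eqxx ?oner_eq0.
under eq_bigr do rewrite (rkf_facept rx0 dual).
by rewrite sum_subset_expr (des_nu hyp_inj rx0 dual rv) addrC subrK.
Qed.
End SharpCones.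

(** * Summing over the regions in the half-space *)

Section Main.
Variables (R : realType) (d n : nat) (a : 'I_n -> 'rV[R]_d).
Notation V := 'rV[R]_d.
Hypothesis hyp_inj : injective (hyp a).
Hypothesis sharp_arr : sharp (arr a).
Variable v : V.
Hypotheses (rv : regular a v) (gen_v : generic_hyperplane (arr a) (orth v)).

(** A chosen point of the face; the default [0] is returned only when no point has sign vector
    [s]. *)
Definition covpt (s : {ffun 'I_n -> option bool}) : V := xget 0 [set x | sgv a x = s].

Lemma sgv_covpt s : iscov a s -> sgv a (covpt s) = s.
Proof. by move=> /asboolP[x xs]; rewrite /covpt; case: xgetP => [y _ //|/(_ x)]. Qed.

(** A small step from a point of the face in direction [- v] keeps the nonzero signs and fills the
    zeros with the signs of [- v]. *)
Lemma iscov_upper s : iscov a s -> iscov a (upper a v s).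
Proof.
move=> /asboolP[z <-]; apply/asboolP.
have [e e0 he] := sg3_perturb [seq a i | i <- enum 'I_n] z (- v).
have {}he := he e; rewrite gtr0_norm // lexx in he; have {}he := he isT.
exists (z + e *: - v); apply/ffunP => i; rewrite !ffunE.
have [zi|zi] := eqVneq (dotv (a i) z) 0; last first.
  rewrite he //; first by rewrite /sg3 (negbTE zi).
  by apply: map_f; rewrite mem_enum.
rewrite dotvDr dotvZr dotvNr zi add0r sg3M // {2}/sg3 eqxx /sg3 oppr_eq0.
have /eqP vi := @rv i; rewrite (negbTE vi) oppr_gt0; congr Some.
by rewrite /pside -leNgt le_eqVlt (negbTE vi).
Qed.

Lemma arr_poly_des :
  arr_poly (arr a) =
  \sum_(C \in [set C | region (arr a) C /\ C `<=` neg_halfspace v])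
     ('X^(des (arr a) (ccell a v) C) : {poly int}).
Proof.
have sys s : iscov a s -> zset s = finset.set0 ->
    regular a (covpt s) /\ exists f rho, @dual_system _ _ _ a (covpt s) (rkf a [set: 'I_n]%SET) f rho.
  move=> cs s0; have rs : regular a (covpt s) by apply/zset_regular; rewrite sgv_covpt.
  by split=> //; apply: simplicial_dual_system => //; case: sharp_arr.
rewrite (@fsbig_finType _ _ _ _ _ (fun s => ccell a (covpt s))
  (fun s => [&& iscov a s, zset s == finset.set0 & inneg a v s])); first last.
- move=> C; split=> [[/regionP[x rx ->] sub]|[s /and3P[cs /eqP s0 sv] <-]].
    have cx : iscov a (sgv a x) by apply/asboolP; exists x.
    exists (sgv a x); last by apply/ccell_eqP; rewrite sgv_covpt.
    rewrite cx (iffLR (zset_regular a x) rx) eqxx /=; apply/asboolP => y yx.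
    by rewrite dotvC; apply/sub/ccell_sgv.
  have [rs _] := sys s cs s0.
  split; first by apply/regionP; exists (covpt s).
  move=> y sy; rewrite /neg_halfspace /= dotvC.
  by apply: (@inneg_ccell _ _ _ a v (covpt s)) => //; rewrite sgv_covpt.
- move=> s t /and3P[cs _ _] /and3P[ct _ _] /ccell_eqP; by rewrite !sgv_covpt.
have up0 s : zset (upper a v s) = finset.set0.
  by apply/setP => i; rewrite !inE ffunE; case: (s i).
have upneg s : iscov a s -> inneg a v (upper a v s) = inneg a v s.
  move=> cs; have cu := iscov_upper cs; have [rs [f [rho dual]]] := sys _ cu (up0 s).
  have := @inneg_upper _ _ _ a hyp_inj _ _ f rho rs dual sharp_arr v rv gen_v (covpt s).
  by rewrite !sgv_covpt // => ->.
rewrite (arr_polyE gen_v) (partition_big (upper a v)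
  (fun s => [&& iscov a s, zset s == finset.set0 & inneg a v s])) /=; last first.
  by move=> s /andP[cs sv]; rewrite iscov_upper // up0 eqxx upneg.
apply: eq_bigr => s /and3P[cs /eqP s0 sv]; have [rs [f [rho dual]]] := sys s cs s0.
rewrite -(sum_upper hyp_inj rs dual rv) sgv_covpt //; apply: eq_bigl => t.
case ct : (iscov a t) => //=; case: eqP => [e|]; rewrite ?andbF // andbT.
by rewrite -upneg // e.
Qed.
End Main.

Theorem theoremA (R : realType) (d : nat) (A : set (set 'rV[R]_d)) :
  arrangement A -> sharp A ->
  forall (v : 'rV[R]_d), very_generic A v ->
  forall B : set 'rV[R]_d, region A B -> B v ->
  arr_poly A =
    \sum_(C \in [set C | region A C /\ C `<=` neg_halfspace v])
       ('X^(des A B C) : {poly int}).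
Proof.
move=> [finA linA].
(* The hyperplanes are listed without repetition; injectivity of [hyp] is what lets a wall determine
   its index. *)
have [n [a [hyp_inj ->]]] : exists n (a : 'I_n -> 'rV[R]_d), injective (hyp a) /\ A = arr a.
  have /finite_seqP[s As] := finA.
  have nthA (i : 'I_(size (undup s))) : A (nth set0 (undup s) i).
    by rewrite As /= -mem_undup mem_nth.
  have [a ha] := choice (fun i => linA _ (nthA i)).
  have hypE i : hyp a i = nth set0 (undup s) i by rewrite (ha i).2.
  exists (size (undup s)), a; split=> [i j|].
    rewrite !hypE => /eqP; rewrite nth_uniq ?undup_uniq // => /eqP; exact: val_inj.
  apply/seteqP; split=> [H|_ [i _ <-]]; last by rewrite hypE; exact: nthA.
  rewrite As /= -mem_undup => Hs; have Hi := Hs; rewrite -index_mem in Hi.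
  by exists (Ordinal Hi) => //; rewrite hypE nth_index.
move=> sharp_arr v [nv gen_v] B /regionP[x rx ->] xv.
have rv : regular a v by move=> i; apply: (nv (hyp a i)); exists i.
(* As [v] is on no hyperplane, it is interior to [B], which is therefore its sign cell. *)
have -> : ccell a x = ccell a v by apply/ccell_eqP; rewrite (ccell_regular xv rv).
exact: arr_poly_des.
Qed.
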